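(* If the solution $u\in V^{1,0}_0$ of the space-time variational problem $$(\nabla_x u,\nabla_x w)_Q-(u,\partial_t w)_Q=(f,w)_Q+(u_0,w)_{\Sigma_0}\qquad\text{for all }w\in V^1_{0,\overline 0}$$ (with $f\in L_2(Q)$ and $u_0=0$) also belongs to $V^{\Delta_x,1}_{0,\underline 0}$, then it satisfies the consistency identity $$a_{loc,h}(u,v_h)=\ell_{loc,h}(v_h)\qquad\text{for all }v_h\in V_{0h}.$$
   Context: Domain: $\Omega\subset\mathbb R^d$, $d\in\{1,2,3\}$, is a bounded Lipschitz domain, $0<T<\infty$, $Q=\Omega\times(0,T)$, $\Sigma=\partial\Omega\times(0,T)$, $\Sigma_0=\Omega\times\{0\}$, $\Sigma_T=\Omega\times\{T\}$. For a set $S$, $(\cdot,\cdot)_S$ and $\|\cdot\|_S$ are the $L_2(S)$ inner product and norm. $\nabla_x$, $\Delta_x$ are the spatial gradient and Laplacian. Throughout the paper $f\in L_2(Q)$ and the initial datum is taken to be $u_0=0$. Function spaces: $V^{1,0}_0=\{u\in L_2(Q):\nabla_x u\in[L_2(Q)]^d,\ u=0\text{ on }\Sigma\}$; $V^1_{0,\overline 0}=\{u\in V^{1,0}_0:\partial_t u\in L_2(Q),\ u=0\text{ on }\Sigma_T\}$; $V^1_{0,\underline 0}=\{u\in V^{1,0}_0:\partial_t u\in L_2(Q),\ u=0\text{ on }\Sigma_0\}$; $V^{\Delta_x,1}_0=\{u\in V^{1,0}_0:\Delta_x u\in L_2(Q),\ \partial_t u\in L_2(Q)\}$; $V^{\Delta_x,1}_{0,\underline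 0}=\{u\in V^{\Delta_x,1}_0: u=0\text{ on }\Sigma_0\}$. Discretization (single-patch isogeometric analysis): $\hat Q=(0,1)^{d+1}$ is the parameter domain with a tensor-product mesh $\hat{\mathcal K}_h$ of open knot spans (possibly locally refined), and $\hat{\mathcal S}^p_h$ is a space of splines (B-splines, NURBS or THB-splines) of degree $p$ in every direction, built on open knot vectors. It is assumed that $p\ge2$ and that all interior knot multiplicities $m$ satisfy $m\le p-1$. The geometry map $\Phi:\hat Q\to Q=\Phi(\hat Q)$ is a spline/NURBS map, invertible with smooth inverse on each element. Physical elements are $K=\Phi(\hat K)$, $\hat K\in\hat{\mathcal K}_h$, forming the mesh $\mathcal K_h$. Put $V_h:=\{\hat s\circ\Phi^{-1}:\hat s\in\hat{\mathcal S}^p_h\}$ and $V_{0h}:=V_h\cap V^1_{0,\underline 0}$; then $V_{0h}\subset C^1(\overline Q)$ and $V_{0h}\subset V^{\Delta_x,1}_{0,\underline 0}$. The local mesh size is $h_K=\mathrm{diam}(K)$, and $\delta_K:=\theta_K h_K$ with $\theta_K>0$. Bilinear and linear forms: for $u\in V^{\Delta_x,1}_{0,\underline 0}$ and $v_h\in V_{0h}$, $$a_{loc,h}(u,v_h)=(\partial_t u,v_h)_Q+(\nabla_x u,\nabla_x v_h)_Q+\sum_{K\in\mathcal K_h}\delta_K\Big((\partial_t u,\partial_t v_h)_K+(\nabla_x u,\nabla_x\partial_t v_h)_K-\langle n_x^{\partial K}\cdot\nabla_x u,\partial_t v_h\rangle_{\partial K}\Big),$$ $$\ell_{loc,h}(v_h)=(f,v_h)_Q+\sum_{K\in\mathcal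 K_h}\delta_K(f,\partial_t v_h)_K,$$ where $n_x^{\partial K}$ is the spatial part of the exterior unit normal to $\partial K$ and $\langle\cdot,\cdot\rangle_{\partial K}$ is the $H^{-1/2}(\partial K)\times H^{1/2}(\partial K)$ duality product, so that $(\nabla_x u,\nabla_x\partial_t v_h)_K-\langle n_x^{\partial K}\cdot\nabla_x u,\partial_t v_h\rangle_{\partial K}=-(\Delta_x u,\partial_t v_h)_K$. *)

(* Defs.v *)
From HB Require Import structures.
From mathcomp Require Import all_boot all_order all_algebra.
From mathcomp Require Import all_classical all_reals all_analysis.

Set Implicit Arguments.
Unset Strict Implicit.
Unset Printing Implicit Defensive.

Import Order.TTheory GRing.Theory Num.Theory.
Import numFieldTopology.Exports numFieldNormedType.Exports.

Local Open Scope classical_set_scope.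
Local Open Scope ring_scope.

(** * Lebesgue measure on row vectors *)

(* The sigma-algebra generated by the coordinates, i.e. the Borel one; same
   construction as the library's instance on n.-tuple. *)
Section measurable_rV.
Context (R : realType) (n : nat).

Definition rV_coord (i : 'I_n) (x : 'rV[R]_n) : R := x ord0 i.

Definition rV_display : measure_display.
Proof. exact: (measure_tuple_display default_measure_display). Qed.

Let rV_set0 : g_sigma_preimage rV_coord set0.
Proof. exact: sigma_algebra0. Qed.

Let rV_setC A : g_sigma_preimage rV_coord A -> g_sigma_preimage rV_coord (~` A).
Proof. exact: sigma_algebraC. Qed.

Let rV_bigcup (F : (set 'rV[R]_n)^nat) :
  (forall i, g_sigma_preimage rV_coord (F i)) ->
  g_sigma_preimage rV_coord (\bigcup_i (F i)).
Proof. exact: sigma_algebra_bigcup. Qed.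

HB.instance Definition _ := @isMeasurable.Build rV_display
  'rV[R]_n (g_sigma_preimage rV_coord) rV_set0 rV_setC rV_bigcup.

End measurable_rV.

Section lebesgue_rV.
Context (R : realType).

(* (x, t) |-> (x_0, ..., x_{n-1}, t); the last coordinate is the time *)
Definition snoc n (x : 'rV[R]_n) (t : R) : 'rV[R]_n.+1 :=
  \row_j (if unlift ord_max j is Some i then x ord0 i else t).

Lemma measurable_coord n (i : 'I_n) :
  measurable_fun [set: 'rV[R]_n] (fun x => x ord0 i).
Proof.
move=> _ Y mY; rewrite setTI; apply: sub_sigma_algebra => /=.
rewrite -bigcup_seq/=; exists i => /=; first by rewrite mem_index_enum.
by exists Y => //; rewrite setTI.
Qed.

Lemma measurable_snoc n :
  measurable_fun [set: 'rV[R]_n * R] (fun p => snoc p.1 p.2).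
Proof.
have mc (j : 'I_n.+1) :
    measurable_fun [set: 'rV[R]_n * R] (fun p => snoc p.1 p.2 ord0 j).
  under eq_fun do rewrite mxE; case: unlift => [i|]; last exact: measurable_snd.
  by apply: (measurableT_comp (measurable_coord i)); exact: measurable_fst.
apply: (@measurability _ _ _ _ setT _ (\big[setU/set0]_(i < n.+1) preimage_set_system setT (@rV_coord R n.+1 i) measurable) erefl) => _ [A + <-].
rewrite -bigcup_seq => -[j /= _ [B mB <-]].
rewrite !setTI.
by move: (mc j measurableT B mB); rewrite setTI.
Qed.

Fixpoint lebesgue_rV n : {measure set 'rV[R]_n -> \bar R} :=
  match n with
  | 0 => \d_ (0 : 'rV[R]_0)
  | m.+1 =>
      (* pushforward of lebesgue_rV m \x lebesgue_measure by snoc *)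
      measure_function_pushforward__canonical__measure_function_Measure
        (lebesgue_rV m \x lebesgue_measure)%E (@measurable_snoc m)
  end.

End lebesgue_rV.

(** * L2, smooth functions, weak derivatives *)

Section function_spaces.
Context (R : realType).
Implicit Types n k : nat.

Definition inner n (S : set 'rV[R]_n) (u v : 'rV[R]_n -> R) : R :=
  \int[lebesgue_rV R n]_(x in S) (u x * v x).

Definition sqnorm n (S : set 'rV[R]_n) (u : 'rV[R]_n -> R) : \bar R :=
  (\int[lebesgue_rV R n]_(x in S) ((u x) ^+ 2)%:E)%E.

Definition L2 n (S : set 'rV[R]_n) : set ('rV[R]_n -> R) :=
  [set u | measurable_fun S u /\ (sqnorm S u < +oo)%E].

Definition basis_vec n (i : 'I_n) : 'rV[R]_n := delta_mx ord0 i.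

Definition pderiv n (i : 'I_n) (f : 'rV[R]_n -> R) : 'rV[R]_n -> R :=
  fun x => 'D_(basis_vec i) f x.

Fixpoint Ck n k (f : 'rV[R]_n -> R) : Prop :=
  match k with
  | 0 => continuous f
  | k'.+1 => continuous f /\
      forall i, (forall x, derivable f x (basis_vec i)) /\ Ck k' (pderiv i f)
  end.

Definition smooth n (f : 'rV[R]_n -> R) : Prop := forall k, Ck k f.

Definition smooth_map n m (F : 'rV[R]_n -> 'rV[R]_m) : Prop :=
  forall j, smooth (fun x => F x ord0 j).

(* C_c^infty(U) *)
Definition test_fun n (U : set 'rV[R]_n) (phi : 'rV[R]_n -> R) : Prop :=
  smooth phi /\
  exists C, [/\ compact C, C `<=` U & forall x, ~ C x -> phi x = 0].

Definition is_wderiv n (U : set 'rV[R]_n) (i : 'I_n) (u g : 'rV[R]_n -> R) :=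
  L2 U g /\
  forall phi, test_fun U phi -> inner U u (pderiv i phi) = - inner U g phi.

Definition has_wderiv n (U : set 'rV[R]_n) (i : 'I_n) (u : 'rV[R]_n -> R) :=
  exists g, is_wderiv U i u g.

(* The weak derivative in L2(U), a representative of the a.e. class being
   chosen; junk value 0 if there is none. *)
Definition wderiv n (U : set 'rV[R]_n) (i : 'I_n) (u : 'rV[R]_n -> R) :=
  xget (cst 0 : 'rV[R]_n -> R) [set g | is_wderiv U i u g].

(** * Lipschitz domains *)

Definition dot n (x y : 'rV[R]_n) : R := \sum_i x ord0 i * y ord0 i.

(* the norm of the library on 'rV is the maximum norm *)
Definition enorm n (x : 'rV[R]_n) : R := Num.sqrt (dot x x).

Definition diam n (S : set 'rV[R]_n) : R :=
  sup [set enorm (x.1 - x.2) | x in S `*` S].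

Definition bdry n (S : set 'rV[R]_n) : set 'rV[R]_n := closure S `\` S°.

(* Near each boundary point, Omega is the strict epigraph, in the direction of
   a unit vector nu, of a Lipschitz function gamma of the coordinates
   orthogonal to nu (gamma is constant along nu). *)
Definition bounded_lipschitz_domain n (Omega : set 'rV[R]_n) : Prop :=
  [/\ open Omega, connected Omega, Omega !=set0, bounded_set Omega &
   forall x, bdry Omega x ->
     exists (nu : 'rV[R]_n) (gamma : 'rV[R]_n -> R) (L : R),
     [/\ dot nu nu = 1,
      forall y z, `|gamma y - gamma z| <= L * enorm (y - z),
      forall y s, gamma (y + s *: nu) = gamma y &
      \forall y \near x, Omega y <-> gamma y < dot y nu]].

End function_spaces.

(** * Space-time function spaces *)

Section space_time.
Context (R : realType) (d : nat).
Variables (Omega : set 'rV[R]_d) (T : R).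

Notation X := 'rV[R]_d.+1.

Definition xdir (i : 'I_d) : 'I_d.+1 := lift ord_max i.
Definition tdir : 'I_d.+1 := ord_max.

Definition xpart (z : X) : 'rV[R]_d := \row_i z ord0 (xdir i).
Definition tpart (z : X) : R := z ord0 tdir.

Definition cylinder : set X :=
  [set z | Omega (xpart z) /\ 0 < tpart z < T].
Definition lateral : set X :=
  [set z | bdry Omega (xpart z) /\ 0 < tpart z < T].

Notation Q := cylinder.

(* weak divergence, in L2(U), of the field (q, 0) with spatial part q *)
Definition is_wdivx (U : set X) (q : 'I_d -> X -> R) (g : X -> R) : Prop :=
  L2 U g /\
  forall phi, test_fun U phi ->
    \sum_(i < d) inner U (q i) (pderiv (xdir i) phi) = - inner U g phi.

Definition gradx (U : set X) (u : X -> R) : 'I_d -> X -> R :=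
  fun i => wderiv U (xdir i) u.

Definition is_laplx (U : set X) (u g : X -> R) := is_wdivx U (gradx U u) g.

Definition laplx (U : set X) (u : X -> R) : X -> R :=
  xget (cst 0 : X -> R) [set g | is_laplx U u g].

Definition dt (U : set X) (u : X -> R) : X -> R := wderiv U tdir u.

(* u = 0 on Sigma: u is a limit, in the norm of V^{1,0}, of smooth functions
   that vanish near Sigma. *)
Definition zero_on_lateral (u : X -> R) : Prop :=
  forall e : R, 0 < e -> exists phi : X -> R,
  [/\ smooth phi,
   forall z, lateral z -> \forall y \near z, phi y = 0,
   (sqnorm Q (u \- phi)%R < e%:E)%E &
   forall i, (sqnorm Q (gradx Q u i \- pderiv (xdir i) phi)%R < e%:E)%E].

(* g is the trace on Omega x {s} of a u with u, d_t u in L2(Q): the trace is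
   the extension by continuity of phi |-> phi(., s). *)
Definition is_time_trace (s : R) (u : X -> R) (g : 'rV[R]_d -> R) : Prop :=
  L2 Omega g /\
  forall e : R, 0 < e -> exists phi : X -> R,
  [/\ smooth phi,
   (sqnorm Q (u \- phi)%R < e%:E)%E,
   (sqnorm Q (dt Q u \- pderiv tdir phi)%R < e%:E)%E &
   (sqnorm Omega (fun x => (g x - phi (snoc x s))%R) < e%:E)%E].

Definition time_trace (s : R) (u : X -> R) : 'rV[R]_d -> R :=
  xget (cst 0 : 'rV[R]_d -> R) [set g | is_time_trace s u g].

Definition zero_at_time (s : R) (u : X -> R) : Prop :=
  is_time_trace s u (cst 0).

(* V^{1,0}_0 *)
Definition V10_0 : set (X -> R) :=
  [set u | [/\ L2 Q u, forall i, has_wderiv Q (xdir i) u & zero_on_lateral u]].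

(* V^1_{0,\overline 0}: zero on Sigma_T *)
Definition V1_0top : set (X -> R) :=
  [set u | [/\ V10_0 u, has_wderiv Q tdir u & zero_at_time T u]].

(* V^1_{0,\underline 0}: zero on Sigma_0 *)
Definition V1_0bot : set (X -> R) :=
  [set u | [/\ V10_0 u, has_wderiv Q tdir u & zero_at_time 0 u]].

(* V^{\Delta_x,1}_0 *)
Definition VD1_0 : set (X -> R) :=
  [set u | [/\ V10_0 u, exists g, is_laplx Q u g & has_wderiv Q tdir u]].

(* V^{\Delta_x,1}_{0,\underline 0} *)
Definition VD1_0bot : set (X -> R) :=
  [set u | VD1_0 u /\ zero_at_time 0 u].

Definition weak_solution (f : X -> R) (u0 : 'rV[R]_d -> R) (u : X -> R) : Prop :=
  V10_0 u /\
  forall w, V1_0top w ->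
    \sum_(i < d) inner Q (gradx Q u i) (gradx Q w i) - inner Q u (dt Q w) =
    inner Q f w + inner Omega u0 (time_trace 0 w).

End space_time.

(** * Spline spaces *)

Section splines.
Context (R : realType).
Implicit Types p : nat.

(* Cox-de Boor recursion; 0 / 0 = 0 is built in. The half-open convention at
   the knots is harmless: splines are only evaluated on the open unit cube. *)
Fixpoint bspline1 (Xi : seq R) p (j : nat) (x : R) : R :=
  match p with
  | 0 => if (Xi`_j <= x) && (x < Xi`_j.+1) then 1 else 0
  | p'.+1 =>
      (x - Xi`_j) / (Xi`_(j + p) - Xi`_j) * bspline1 Xi p' j x +
      (Xi`_(j + p).+1 - x) / (Xi`_(j + p).+1 - Xi`_j.+1) * bspline1 Xi p' j.+1 x
  end.

(* open knot vector of degree p on [0, 1], with interior multiplicities at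
   most p - 1 *)
Definition open_knot_vector p (Xi : seq R) : Prop :=
  [/\ sorted <=%R Xi, all (fun x => 0 <= x <= 1) Xi,
      count_mem 0 Xi = p.+1, count_mem 1 Xi = p.+1 &
      forall x, 0 < x < 1 -> (count_mem x Xi <= p.-1)%N].

Variable n : nat.
Notation X := 'rV[R]_n.

(* A box is given by its lower and upper corners. *)
Definition obox (K : X * X) : set X :=
  [set x | forall i, K.1 ord0 i < x ord0 i < K.2 ord0 i].
Definition cbox (K : X * X) : set X :=
  [set x | forall i, K.1 ord0 i <= x ord0 i <= K.2 ord0 i].

Definition unit_box : X * X := (const_mx 0, const_mx 1).

(* nonempty open knot spans of a tensor-product knot vector *)
Definition grid (Xi : 'I_n -> seq R) : set (X * X) :=
  [set K : X * X | forall i,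
    [/\ K.1 ord0 i \in Xi i, K.2 ord0 i \in Xi i, K.1 ord0 i < K.2 ord0 i &
     forall x, x \in Xi i -> ~~ (K.1 ord0 i < x < K.2 ord0 i)]].

Definition bspline_index p (Xi : 'I_n -> seq R) : set {ffun 'I_n -> nat} :=
  [set J | forall i, (J i + p.+1 < size (Xi i))%N].

Definition bspline p (Xi : 'I_n -> seq R) (J : {ffun 'I_n -> nat}) : X -> R :=
  fun x => \prod_(i < n) bspline1 (Xi i) p (J i) (x ord0 i).

Definition bspline_basis p (Xi : 'I_n -> seq R) : set (X -> R) :=
  [set bspline p Xi J | J in bspline_index p Xi].

Definition nurbs_basis p (Xi : 'I_n -> seq R) (w : {ffun 'I_n -> nat} -> R) :
    set (X -> R) :=
  [set (fun x => w J * bspline p Xi J x /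
     \sum_(I \in bspline_index p Xi) w I * bspline p Xi I x)
     | J in bspline_index p Xi].

Definition lin_span (B : set (X -> R)) : set (X -> R) :=
  [set s | exists m (c : 'I_m -> R) (b : 'I_m -> X -> R),
     (forall k, B (b k)) /\ s = (fun x => \sum_(k < m) c k * b k x)].

Definition supp (s : X -> R) : set X := [set x | obox unit_box x /\ s x <> 0].

(** Truncated hierarchical B-splines: the level-l grid has knot vectors Xi l,
    and marked l is the set of its cells that are refined. *)

Definition refined_domain (marked : nat -> set (X * X)) (l : nat) : set X :=
  match l with
  | 0 => cbox unit_box
  | l'.+1 => \bigcup_(K in marked l') cbox K
  end.

Definition hierarchy p (L : nat) (Xi : nat -> 'I_n -> seq R)
    (marked : nat -> set (X * X)) : Prop :=
  [/\ forall l i, (l <= L)%N -> open_knot_vector p (Xi l i),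
   forall l i, (l < L)%N -> subseq (Xi l i) (Xi l.+1 i),
   forall l, (l < L)%N -> marked l `<=` grid (Xi l),
   forall l, (L <= l)%N -> marked l = set0 &
   forall l, refined_domain marked l.+1 `<=` refined_domain marked l].

Definition hierarchical_mesh (L : nat) (Xi : nat -> 'I_n -> seq R)
    (marked : nat -> set (X * X)) : set (X * X) :=
  [set K : X * X | exists l, [/\ (l <= L)%N, grid (Xi l) K,
     obox K `<=` refined_domain marked l &
     ~ (obox K `<=` refined_domain marked l.+1)]].

(* t is the truncation of s with respect to the basis of Xi and to D: in the
   expansion of s, the basis functions supported in D are dropped. *)
Definition is_truncation p (Xi : 'I_n -> seq R) (D : set X) (s t : X -> R) :=
  exists c : {ffun 'I_n -> nat} -> R,
  (forall x, obox unit_box x ->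
     s x = \sum_(J \in bspline_index p Xi) c J * bspline p Xi J x) /\
  t = (fun x => \sum_(J \in bspline_index p Xi `&`
         [set J | ~ (supp (bspline p Xi J) `<=` D)]) c J * bspline p Xi J x).

Fixpoint thb_basis p (Xi : nat -> 'I_n -> seq R) (marked : nat -> set (X * X))
    (l : nat) : set (X -> R) :=
  match l with
  | 0 => bspline_basis p (Xi 0%N)
  | l'.+1 =>
      [set t | exists2 s, thb_basis p Xi marked l' s &
         ~ (supp s `<=` refined_domain marked l) /\
         is_truncation p (Xi l) (refined_domain marked l) s t] `|`
      [set s | bspline_basis p (Xi l) s /\ supp s `<=` refined_domain marked l]
  end.

(* spline_space p S K: S is a space of B-splines, NURBS or THB-splines of
   degree p in every direction, with mesh K *)
Inductive spline_space p : set (X -> R) -> set (X * X) -> Prop :=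
| BSplineSpace (Xi : 'I_n -> seq R) of
    (forall i, open_knot_vector p (Xi i)) :
    spline_space p (lin_span (bspline_basis p Xi)) (grid Xi)
| NurbsSpace (Xi : 'I_n -> seq R) (w : {ffun 'I_n -> nat} -> R) of
    (forall i, open_knot_vector p (Xi i)) & (forall J, 0 < w J) :
    spline_space p (lin_span (nurbs_basis p Xi w)) (grid Xi)
| ThbSpace (L : nat) (Xi : nat -> 'I_n -> seq R)
    (marked : nat -> set (X * X)) of hierarchy p L Xi marked :
    spline_space p (lin_span (thb_basis p Xi marked L))
      (hierarchical_mesh L Xi marked).

(* Phi is a bijection from the unit cube onto Q whose components are splines
   (of some degree), and on each closed mesh cell it is a smooth
   diffeomorphism onto its image: Phi and its inverse are restrictions of the
   smooth maps F and G. *)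
Definition geometry_map (Khat : set (X * X)) (Q : set X) (Phi : X -> X) : Prop :=
  [/\ set_bij (obox unit_box) Q Phi,
   exists p S K, spline_space p S K /\
     forall i, exists2 s, S s &
       forall x, obox unit_box x -> Phi x ord0 i = s x &
   forall K, Khat K -> exists F G : X -> X,
     [/\ smooth_map F, smooth_map G &
      forall x, obox K x -> F x = Phi x /\ G (Phi x) = x]].

(* v \o Phi = s on the unit cube, i.e. v = s \o Phi^-1 on Phi(unit cube) *)
Definition mapped_space (S : set (X -> R)) (Phi : X -> X) : set (X -> R) :=
  [set v | exists2 s, S s & forall x, obox unit_box x -> v (Phi x) = s x].

End splines.

(** * The locally stabilized scheme *)

Section scheme.
Context (R : realType) (d : nat).
Variables (Omega : set 'rV[R]_d) (T : R).

Notation X := 'rV[R]_d.+1.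
Notation Q := (cylinder Omega T).

Variables (Khat : set (X * X)) (Phi : X -> X) (theta : X * X -> R).

Definition element (K : X * X) : set X := Phi @` obox K.
Definition delta (K : X * X) : R := theta K * diam (element K).

(* The pairing < n_x . q, w >_{dK} of the normal trace in H^{-1/2}(dK) of the
   field (q, 0) in H(div; K), whose divergence is divq, with the trace in
   H^{1/2}(dK) of w in H^1(K). As usual the normal trace of an H(div) field is
   the functional w |-> (q, grad w)_K + (div q, w)_K, which only depends on the
   trace of w. *)
Definition normal_pairing (K : set X) (q : 'I_d -> X -> R) (divq w : X -> R) : R :=
  \sum_(i < d) inner K (q i) (gradx K w i) + inner K divq w.

Definition a_loc (u v : X -> R) : R :=
  inner Q (dt Q u) v + \sum_(i < d) inner Q (gradx Q u i) (gradx Q v i) +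
  \sum_(K \in Khat) delta K *
    (inner (element K) (dt Q u) (dt Q v)
     + \sum_(i < d) inner (element K) (gradx Q u i) (gradx (element K) (dt Q v) i)
     - normal_pairing (element K) (gradx Q u) (laplx Q u) (dt Q v)).

Definition l_loc (f v : X -> R) : R :=
  inner Q f v +
  \sum_(K \in Khat) delta K * inner (element K) f (dt Q v).

(* V_{0h} *)
Definition V0h (S : set (X -> R)) : set (X -> R) :=
  mapped_space S Phi `&` V1_0bot Omega T.

End scheme.

(* Main.v *)
From HB Require Import structures.
Require Import Defs.
From mathcomp Require Import all_boot all_order all_algebra.
From mathcomp Require Import all_classical all_reals all_analysis.
From mathcomp Require Import measurable_realfun ring lra.

(** In the stabilization term of an element K the normal pairing was added
    precisely so that the spatial gradients cancel: by its definition the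
    bracket is (dt u, dt v)_K - (laplx u, dt v)_K. Consistency therefore
    amounts to two facts about u on the cylinder Q.

    The first is that the equation dt u - laplx u = f holds almost everywhere
    in Q ([weak_solution_ae]). A function phi in C_c^infty(Q) belongs to
    V^1_{0,top} and its weak derivatives are the classical ones, so it may be
    inserted in the weak formulation; moving the derivatives back onto u by the
    definitions of dt u and laplx u shows that dt u - laplx u - f is orthogonal
    to every test function, hence vanishes almost everywhere by the fundamental
    lemma of the calculus of variations ([du_bois_reymond]). Tested with dt v
    on each element, and with v on Q, it gives all the terms with f.

    The second is Green's formula (gradx u, gradx v)_Q = - (laplx u, v)_Q for
    v in V^{1,0}_0 ([green_formula]). It is the definition of laplx u when v is
    a test function. A general v is approximated by smooth phi vanishing near
    the lateral boundary; these need not vanish at t = 0 and t = T, but after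
    multiplication by a cutoff chi_k in time only, which commutes with the
    spatial gradient, they are test functions. One lets phi tend to v for
    fixed k, and then k tend to infinity by dominated convergence.

    The remaining work is the theory behind these two facts. Bump functions are
    built from exp(-1/t). That a smooth function has its classical derivatives
    as weak derivatives rests on the vanishing of the integral of a derivative
    with compact support ([int_pderiv_eq0]), which is Fubini's theorem together
    with the fundamental theorem of calculus along one coordinate. The
    restriction of the equation to an element K needs K to be measurable: it is
    the continuous image of an open box, thus a countable union of compact
    sets ([geometry_map_element]). *)

Set Implicit Arguments.
Unset Strict Implicit.
Unset Printing Implicit Defensive.

Import Order.TTheory GRing.Theory Num.Theory.
Import numFieldTopology.Exports numFieldNormedType.Exports.

Local Open Scope classical_set_scope.
Local Open Scope ring_scope.

(** * Smooth functions *)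

Section smooth_calculus.
Context (R : realType).
Implicit Types n : nat.

(** Smoothness is a coinductive notion: a class of functions that is stable
    under partial derivatives and consists of continuous functions consists of
    smooth ones. All smoothness proofs below exhibit such a class. *)
Lemma smooth_coind n (A : set ('rV[R]_n -> R)) :
    (forall f, A f -> continuous f /\
       forall i, (forall x, derivable f x (basis_vec R i)) /\ A (pderiv i f)) ->
  A `<=` @smooth R n.
Proof.
move=> AP f Af k; elim: k f Af => [|k IHk] f /AP[cf df] //=.
by split=> // i; split; [apply: (df i).1|apply/IHk/(df i).2].
Qed.

Lemma smooth_continuous n (f : 'rV[R]_n -> R) : smooth f -> continuous f.
Proof. by move=> /(_ 0%N). Qed.

Lemma smooth_derivable n (f : 'rV[R]_n -> R) i x :
  smooth f -> derivable f x (basis_vec R i).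
Proof. by move=> /(_ 1%N) /= [_ /(_ i) []]. Qed.

Lemma smooth_pderiv n (f : 'rV[R]_n -> R) i : smooth f -> smooth (pderiv i f).
Proof. by move=> sf k; have [_ /(_ i) []] := sf k.+1. Qed.

Lemma near_esym (T : topologicalType) U (f g : T -> U) (x : T) :
  {near x, f =1 g} -> {near x, g =1 f}.
Proof. by move=> fg; near=> y; apply/esym; near: y. Unshelve. all: by end_near. Qed.

Lemma near_eq_continuous (T U : topologicalType) (f g : T -> U) (x : T) :
  {near x, f =1 g} -> {for x, continuous g} -> {for x, continuous f}.
Proof.
move=> fg cg; rewrite /prop_for /continuous_at (nbhs_singleton fg).
by apply: cvg_trans cg; apply: near_eq_cvg; exact: near_esym.
Qed.

(** Used to glue a smooth function that vanishes near the boundary of an open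
    set to the zero function outside. *)
Lemma smooth_local n (f : 'rV[R]_n -> R) :
  (forall x : 'rV[R]_n, exists2 g, smooth g & {near x, f =1 g}) -> smooth f.
Proof.
move: f; apply: smooth_coind => f fg; split=> [x|i].
  have [g sg eg] := fg x.
  by apply: (@near_eq_continuous _ _ f g x eg); exact: smooth_continuous.
split=> x; have [g sg eg] := fg x.
  by apply: near_eq_derivable (near_esym eg) _; exact: smooth_derivable.
exists (pderiv i g); first exact: smooth_pderiv.
have := near_join eg; apply: filterS => y ey.
exact: near_eq_derive.
Qed.

Definition flat (m : nat) (t : R) : R :=
  if 0 < t then t^-1 ^+ m * expR (- t^-1) else 0.

Lemma flat_ge0 m t : 0 <= flat m t.
Proof.
rewrite /flat; case: ifPn => // t0.
by rewrite mulr_ge0 ?expR_ge0// exprn_ge0// invr_ge0 ltW.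
Qed.

Lemma flat_gt0 m t : (0 < flat m t) = (0 < t).
Proof.
rewrite /flat; case: ifPn => [t0|_]; last by rewrite ltxx.
by rewrite mulr_gt0 ?expR_gt0// exprn_gt0// invr_gt0.
Qed.

(** The quantitative form of the flatness at 0: exp(1/t) dominates the term of
    degree m+2 of its power series at 1/t. *)
Lemma flat_le m t : flat m t <= (m.+2)`!%:R * t ^+ 2.
Proof.
rewrite /flat; case: ifPn => [t0|_]; last by rewrite mulr_ge0// sqr_ge0.
have ti0 : 0 < t^-1 by rewrite invr_gt0.
have := @expR_ge1Dxn R t^-1 m.+1 (ltW ti0).
move=> /(le_trans (ler_wpDl ler01 (lexx _))); rewrite ler_pdivrMr ?ltr0n ?fact_gt0//.
move=> H; rewrite expRN ler_pdivrMr ?expR_gt0//.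
have -> : t^-1 ^+ m = t ^+ 2 * t^-1 ^+ m.+2.
  by rewrite !exprS; field; rewrite gt_eqF.
rewrite (_ : _ * _ * expR _ = t ^+ 2 * (expR t^-1 * (m.+2)`!%:R)); last by ring.
by rewrite ler_wpM2l ?sqr_ge0.
Qed.

Lemma is_derive_ext (V : normedModType R) (f g : V -> R) (x v : V) (a b : R) :
  is_derive x v f a -> f =1 g -> a = b -> is_derive x v g b.
Proof. by move=> df /funext <- <-. Qed.

(** The family is closed under differentiation up to linear combinations, which
    is why the exponent m is kept as a parameter. At t = 0 the difference
    quotient is O(t) by [flat_le]. *)
Lemma is_derive_flat m (t : R) : is_derive t 1 (flat m) (flat m.+2 t - m%:R * flat m.+1 t).
Proof.
have [t0|t0|->] := ltgtP t 0.
- have -> : flat m.+2 t - m%:R * flat m.+1 t = 0.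
    by rewrite /flat ltNge (ltW t0)/= mulr0 subr0.
  apply: (@near_eq_is_derive _ _ _ (cst 0)) => //.
  near=> s; rewrite /flat ifF//; apply/negbTE; rewrite -leNgt; apply: ltW.
  by near: s; exact: lt_nbhsl.
- have tn0 : t != 0 by rewrite gt_eqF.
  pose g := (fun s : R => (s^-1) ^+ m * expR (- s^-1)).
  apply: (@near_eq_is_derive _ _ _ g).
    near=> s; rewrite /flat ifT//.
    by near: s; exact: lt_nbhsr.
  have dV : is_derive t 1 (fun s : R => s^-1) (- t^-2).
    apply: is_derive_eq; first exact: (@is_deriveV _ id).
    by rewrite /GRing.scale /= mulr1.
  have dE : is_derive t 1 (fun s : R => expR (- s^-1)) (expR (- t^-1) * t^-2).
    have dN : is_derive t 1 (fun s : R => - s^-1) (t^-2).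
      by have := is_deriveN dV; rewrite opprK.
    exact: (@is_derive1_comp _ expR _ t _ _ (is_derive_expR _) dN).
  have dX := is_deriveX m dV.
  apply: is_derive_ext (is_deriveM dX dE) _ _.
    by move=> s; rewrite /g exprfctE.
  rewrite exprfctE /flat t0 /GRing.scale /=.
  case: m {g dX} => [|m] /=; first by rewrite !expr0; field.
  by rewrite !exprS [in RHS]/=; field.
- have -> : flat m.+2 0 - m%:R * flat m.+1 0 = 0.
    by rewrite /flat ltxx mulr0 subr0.
  have fl : (fun h : R => h^-1 *: (flat m (h *: 1 + 0) - flat m 0)) @ 0^' --> (0 : R).
    apply/cvgrPdist_le => e e0; near=> h.
    rewrite /flat ltxx -/(flat m _) subr0 sub0r normrN /GRing.scale /= mulr1 addr0.
    rewrite normrM normfV (ger0_norm (flat_ge0 _ _)).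
    have h0 : 0 < `|h| by rewrite normr_gt0; near: h; exact: nbhs_dnbhs_neq.
    rewrite mulrC ler_pdivrMr//; apply: le_trans (flat_le _ _) _.
    rewrite -real_normK ?num_real// expr2 mulrA ler_pM2r//.
    have c0 : 0 < (m.+2)`!%:R :> R by rewrite ltr0n fact_gt0.
    rewrite mulrC -ler_pdivlMr//.
    near: h; apply: dnbhs0_le; exact: divr_gt0.
  split; first by apply/cvg_ex; exists 0.
  exact: cvg_lim fl.
Unshelve. all: by end_near. Qed.

Lemma flat_continuous m : continuous (flat m).
Proof.
move=> t; apply/differentiable_continuous/derivable1_diffP.
by case: (is_derive_flat m t).
Qed.

Lemma is_derive_comp1 (V : normedModType R) (f : V -> R) (g : R -> R) (x v : V) (df dg : R) :
  is_derive x v f df -> is_derive (f x) 1 g dg ->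
  is_derive x v (fun y => g (f y)) (dg * df).
Proof.
move=> [fx <-] gx.
pose F (h : R) := f (h *: v + x).
have dF : is_derive (0 : R) 1 F ('D_v f x).
  split; first exact: (derivable1P f x v).1.
  rewrite /derive; set g1 := fun h => h^-1 *: _; set g2 := fun h => h^-1 *: _.
  suff -> : g1 = g2 by []; apply/funext => h.
  by rewrite /g1 /g2 /F /= addr0 scale0r add0r [_%:A]mulr1.
have gF : is_derive (F 0) 1 g dg by rewrite /F scale0r add0r.
have [gFd gFE] := @is_derive1_comp _ g F 0 _ _ gF dF.
split; first exact: (derivable1P (g \o f) x v).2.
rewrite -gFE /derive; set g1 := fun h => h^-1 *: _; set g2 := fun h => h^-1 *: _.
suff -> : g1 = g2 by []; apply/funext => h.
by rewrite /g1 /g2 /F /= addr0 scale0r add0r [_%:A]mulr1.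
Qed.

Lemma is_derive_coord n (i j : 'I_n) (x : 'rV[R]_n) :
  is_derive x (basis_vec R i) (fun y : 'rV[R]_n => y ord0 j) (i == j)%:R.
Proof.
have E : (fun h : R => h^-1 *: (((h *: basis_vec R i + x) ord0 j) - x ord0 j)) @ 0^'
    --> ((i == j)%:R : R).
  apply: cvg_near_cst; near=> h.
  rewrite !mxE eqxx /= addrK /GRing.scale/= eq_sym mulKf//.
  by near: h; exact: nbhs_dnbhs_neq.
split; first by apply/cvg_ex; eexists; exact: E.
exact: cvg_lim E.
Unshelve. all: by end_near. Qed.

(** A class of functions containing the bump functions and cutoffs used below.
    It is stable under partial derivatives because each generator is, so
    [smooth_coind] applies to it. *)
Inductive elementary n : ('rV[R]_n -> R) -> Prop :=
| Elem_smooth f of smooth f : elementary f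
| Elem_cst c : elementary (cst c)
| Elem_flat m i a b : elementary (fun x => flat m (a * x ord0 i + b))
| Elem_add f g of elementary f & elementary g : elementary (fun x => f x + g x)
| Elem_mul f g of elementary f & elementary g : elementary (fun x => f x * g x)
| Elem_exp f of elementary f : elementary (fun x => expR (f x)).

Lemma elementary_continuous n (f : 'rV[R]_n -> R) : elementary f -> continuous f.
Proof.
elim=> {f} [f /smooth_continuous//|c x|m i a b x|f g _ cf _ cg x|f g _ cf _ cg x|f _ cf x].
- exact: cst_continuous.
- apply: (@continuous_comp _ _ _ (fun x : 'rV[R]_n => a * x ord0 i + b) (flat m)).
    apply: continuousD; last exact: cst_continuous.
    by apply: continuousM; [exact: cst_continuous|exact: coord_continuous].
  exact: flat_continuous.
- by apply: continuousD; [exact: cf|exact: cg].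
- by apply: continuousM; [exact: cf|exact: cg].
- by apply: (@continuous_comp _ _ _ f expR); [exact: cf|exact: continuous_expR].
Qed.

Lemma elementary_pderiv n (f : 'rV[R]_n -> R) i : elementary f ->
  exists2 g, elementary g & forall x, is_derive x (basis_vec R i) f (g x).
Proof.
elim=> {f} [f sf|c|m j a b|f g ef [f' ef' df] eg [g' eg' dg]|
            f g ef [f' ef' df] eg [g' eg' dg]|f ef [f' ef' df]].
- exists (pderiv i f); first exact/Elem_smooth/smooth_pderiv.
  by move=> x; apply/derivableP/smooth_derivable.
- by exists (cst 0); [exact: Elem_cst|move=> x; exact: is_derive_cst].
- exists (fun x => (flat m.+2 (a * x ord0 j + b) + - m%:R * flat m.+1 (a * x ord0 j + b)) *
                   (a * (i == j)%:R)).
    apply: Elem_mul; last exact: Elem_cst.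
    apply: Elem_add; first exact: Elem_flat.
    by apply: Elem_mul; [exact: Elem_cst|exact: Elem_flat].
  move=> x; apply: (@is_derive_comp1 _ (fun x : 'rV[R]_n => a * x ord0 j + b)).
    have dM := is_deriveM (is_derive_cst a x _) (is_derive_coord i j x).
    apply: is_derive_ext (is_deriveD dM (is_derive_cst b x _)) _ _ => //.
    by rewrite addr0 scaler0 addr0.
  by rewrite mulNr; exact: is_derive_flat.
- exists (fun x => f' x + g' x); first exact: Elem_add.
  by move=> x; exact: is_deriveD.
- exists (fun x => f x * g' x + g x * f' x); first by apply: Elem_add; exact: Elem_mul.
  by move=> x; exact: is_deriveM.
- exists (fun x => expR (f x) * f' x); first by apply: Elem_mul => //; exact: Elem_exp.
  by move=> x; apply: is_derive_comp1.
Qed.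

Lemma elementary_smooth n (f : 'rV[R]_n -> R) : elementary f -> smooth f.
Proof.
move: f; apply: smooth_coind => f ef; split; first exact: elementary_continuous.
move=> i; have [g eg dg] := elementary_pderiv i ef; split; first by move=> x; case: (dg x).
rewrite (_ : pderiv i f = g)//; apply/funext => x.
by rewrite /pderiv; case: (dg x).
Qed.

Lemma smoothM n (f g : 'rV[R]_n -> R) : smooth f -> smooth g ->
  smooth (fun x => f x * g x).
Proof. by move=> sf sg; apply/elementary_smooth/Elem_mul; exact: Elem_smooth. Qed.

Lemma smooth_cst n c : smooth (cst c : 'rV[R]_n -> R).
Proof. exact/elementary_smooth/Elem_cst. Qed.

End smooth_calculus.

(** * Boxes and the Borel structure of row vectors *)

Section boxes.
Context (R : realType).
Implicit Types n : nat.

Lemma oboxI n (K L : 'rV[R]_n * 'rV[R]_n) :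
  obox K `&` obox L =
  obox (\row_i Num.max (K.1 ord0 i) (L.1 ord0 i),
        \row_i Num.min (K.2 ord0 i) (L.2 ord0 i)).
Proof.
apply/seteqP; split => x /=.
  move=> [Kx Lx] i; rewrite !mxE gt_max lt_min.
  by have /andP[-> ->] := Kx i; have /andP[-> ->] := Lx i.
move=> H; split=> i; have := H i; rewrite !mxE gt_max lt_min.
  by move=> /andP[/andP[-> _] /andP[-> _]].
by move=> /andP[/andP[_ ->] /andP[_ ->]].
Qed.

Definition cube n (M : R) : 'rV[R]_n * 'rV[R]_n := (const_mx (- M), const_mx M).

Lemma cubeP n M (x : 'rV[R]_n) : obox (cube n M) x <-> forall i, `|x ord0 i| < M.
Proof. by split=> H i; have := H i; rewrite !mxE ltr_norml. Qed.

Lemma bigcup_cube n : \bigcup_k obox (cube n k%:R) = setT.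
Proof.
apply/seteqP; split=> // x _.
have [k xk] : exists k : nat, forall i, `|x ord0 i| < k%:R.
  exists (\max_(i < n) (Num.trunc `|x ord0 i|).+1)%N => i.
  apply: lt_le_trans (truncnS_gt _) _.
  by rewrite ler_nat (leq_bigmax i).
by exists k => //; exact/cubeP.
Qed.

(** As the boxes form a pi-system ([oboxI]), Dynkin's theorem lets one check on
    boxes any property that passes to complements and to countable disjoint
    unions. *)
Lemma measurable_rV_obox n :
  @measurable _ 'rV[R]_n = <<s range (@obox R n) >>.
Proof.
apply/seteqP; split; last first.
  apply: smallest_sub; first exact: sigma_algebra_measurable.
  move=> _ [K _ <-].
  have -> : obox K = \bigcap_(i in [set: 'I_n])
     ((fun x : 'rV[R]_n => x ord0 i) @^-1` `]K.1 ord0 i, K.2 ord0 i[%classic).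
    apply/seteqP; split=> x /= H i; first by move=> _ /=; rewrite in_itv/=; exact: H.
    by have /= := H i I; rewrite in_itv.
  rewrite bigcap_mkcond; apply: fin_bigcap_measurable => // i _.
  by rewrite mem_set// -[X in measurable X]setTI; exact: measurable_coord.
apply: smallest_sub; first exact: smallest_sigma_algebra.
move=> A; rewrite -bigcup_seq => -[i /= _ [B mB <-]].
pose T' := g_sigma_algebraType (range (@obox R n)).
suff : measurable_fun [set: T'] (rV_coord i : T' -> R) by move=> /(_ measurableT B mB).
apply: (measurability _ (RGenOInfty.measurableE R)) => _ [_ [a ->] <-].
rewrite setTI.
have -> : (rV_coord i : T' -> R) @^-1` `]a, +oo[%classic =
    \bigcup_k obox (\row_j (if j == i then a else - k%:R), const_mx k%:R).
  apply/seteqP; split=> x /=; last first.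
    by move=> [k _ /(_ i)]/=; rewrite !mxE eqxx in_itv/= andbT => /andP[].
  rewrite in_itv/= andbT => ax.
  have [k _ /cubeP xk] : (\bigcup_k obox (cube n k%:R)) x by rewrite bigcup_cube.
  exists k => // j; rewrite !mxE; have := xk j; rewrite ltr_norml => /andP[xjk ->].
  by rewrite andbT; case: eqP => // ->.
by apply: bigcupT_measurable => k; apply: sub_sigma_algebra; exact: imageT.
Qed.

Lemma obox_measurable n K : measurable (@obox R n K).
Proof. by rewrite measurable_rV_obox; apply: sub_sigma_algebra; exists K. Qed.

Definition ratbox n (q : 'rV[rat]_n * 'rV[rat]_n) : 'rV[R]_n * 'rV[R]_n :=
  (map_mx ratr q.1, map_mx ratr q.2).

(** Rational corners make the boxes countably many; asking for the closed box
    inside U leaves room for bump functions supported in U. *)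
Lemma nbhs_ratbox n (U : set 'rV[R]_n) (x : 'rV[R]_n) : nbhs x U ->
  exists q, obox (ratbox q) x /\ cbox (ratbox q) `<=` U.
Proof.
move=> /nbhs_ballP[e /= e0 xU].
have /boolp.choice[a Pa] (i : 'I_n) : exists q : rat, ratr q \in `]x ord0 i - e, x ord0 i[.
  by apply: rat_in_itvoo; rewrite ltrBlDr ltrDl.
have /boolp.choice[b Pb] (i : 'I_n) : exists q : rat, ratr q \in `]x ord0 i, x ord0 i + e[.
  by apply: rat_in_itvoo; rewrite ltrDl.
exists (\row_i a i, \row_i b i); split=> [i|y yab].
  rewrite !mxE; have := Pa i; have := Pb i; rewrite !in_itv/=.
  by move=> /andP[-> _] /andP[_ ->].
apply: xU; split=> // i j; rewrite ord1.
have := Pa j; have := Pb j; have := yab j; rewrite !mxE !in_itv/= /ball/=.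
by move=> /andP[? ?] /andP[? ?] /andP[? ?]; rewrite ltr_norml; lra.
Qed.

Lemma open_bigcup_ratbox n (U : set 'rV[R]_n) : open U ->
  U = \bigcup_(q in [set q | cbox (ratbox q) `<=` U]) obox (ratbox q).
Proof.
move=> oU; apply/seteqP; split=> x.
  by move=> Ux; have [q [qx qU]] := nbhs_ratbox (open_nbhs_nbhs (conj oU Ux)); exists q.
by move=> [q qU qx]; apply: qU => i; have /andP[/ltW-> /ltW->] := qx i.
Qed.

Lemma rV_open_measurable n (U : set 'rV[R]_n) : open U -> measurable U.
Proof.
move=> /open_bigcup_ratbox ->; rewrite bigcup_mkcond.
apply: countable_bigcupT_measurable => // q.
by case: ifP => _; [exact: obox_measurable|exact: measurable0].
Qed.

Lemma rV_compact_measurable n (C : set 'rV[R]_n) : compact C -> measurable C.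
Proof.
move=> cC; rewrite -[C]setCK; apply: measurableC; apply: rV_open_measurable.
apply: closed_openC.
have h : hausdorff_space 'rV[R]_n by exact: norm_hausdorff.
exact: compact_closed h cC.
Qed.

Lemma rV_continuous_measurable n (f : 'rV[R]_n -> R) :
  continuous f -> measurable_fun setT f.
Proof.
move=> cf; apply: (measurability _ (RGenOInfty.measurableE R)) => _ [_ [a ->] <-].
rewrite setTI; apply: rV_open_measurable.
by apply: open_comp; [move=> x _; exact: cf|exact: interval_open].
Qed.

Lemma smooth_measurable n (D : set 'rV[R]_n) (f : 'rV[R]_n -> R) :
  smooth f -> measurable_fun D f.
Proof.
move=> sf; have h := rV_continuous_measurable (smooth_continuous sf).
exact: measurable_funTS.
Qed.

Lemma lebesgue_rVS n (A : set 'rV[R]_n.+1) :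
  lebesgue_rV R n.+1 A =
  (lebesgue_rV R n \x lebesgue_measure)%E ((fun p => snoc p.1 p.2) @^-1` A).
Proof. by []. Qed.

Lemma snoc_lift n (x : 'rV[R]_n) t i : snoc x t ord0 (lift ord_max i) = x ord0 i.
Proof. by rewrite mxE liftK. Qed.

Lemma snoc_max n (x : 'rV[R]_n) t : snoc x t ord0 ord_max = t.
Proof. by rewrite mxE unlift_none. Qed.

Lemma snoc_cube n M : (fun p : 'rV[R]_n * R => snoc p.1 p.2) @^-1` obox (cube n.+1 M) =
  obox (cube n M) `*` `]-M, M[%classic.
Proof.
apply/seteqP; split=> -[x t] /=.
  move=> /cubeP H; split.
    by apply/cubeP => i; have := H (lift ord_max i); rewrite snoc_lift.
  by have := H ord_max; rewrite snoc_max ltr_norml in_itv.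
move=> [/cubeP H]; rewrite in_itv/= -ltr_norml => tM; apply/cubeP => j.
by case: (unliftP ord_max j) => [i|] ->; rewrite ?snoc_lift ?snoc_max.
Qed.

(** Finiteness on cubes is proved through the recursive definition of the
    measure; it gives sigma-finiteness, which Fubini's theorem requires. *)
Lemma lebesgue_rV_cube n M : (lebesgue_rV R n (obox (cube n M)) < +oo)%E.
Proof.
elim: n => [|n IHn]; first by rewrite /= diracE ltry.
rewrite lebesgue_rVS snoc_cube product_measure1E//; last exact: obox_measurable.
apply: lte_mul_pinfty => //; first by rewrite ge0_fin_numE.
have := @lebesgue_measure_itv R `]- M, M[; rewrite /= => ->; case: ifP => _; rewrite ?ltry//.
Qed.

Lemma coord_le_norm n (x : 'rV[R]_n) i : `|x ord0 i| <= `|x|.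
Proof. by rewrite [leRHS]/Num.norm/= mx_normrE; apply: le_trans (le_bigmax _ _ (ord0, i)). Qed.

Lemma bounded_cube n (A : set 'rV[R]_n) : bounded_set A ->
  exists M, A `<=` obox (cube n M).
Proof.
move=> [M [_ AM]]; exists (M + 2) => x Ax; apply/cubeP => i.
apply: (@le_lt_trans _ _ (M + 1)); last by rewrite ltrD2l ltr1n.
apply: le_trans (coord_le_norm x i) _.
by apply: AM => //; rewrite ltrDl.
Qed.

Lemma lebesgue_rV_bounded n (A : set 'rV[R]_n) : measurable A -> bounded_set A ->
  (lebesgue_rV R n A < +oo)%E.
Proof.
move=> mA /bounded_cube[M AM]; apply: le_lt_trans (lebesgue_rV_cube n M).
by apply: le_measure; rewrite ?inE//; exact: obox_measurable.
Qed.

Lemma sigma_finite_lebesgue_rV n : sigma_finite setT (lebesgue_rV R n).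
Proof.
exists (fun k => obox (cube n k%:R)); first by rewrite bigcup_cube.
by move=> k; split; [exact: obox_measurable|exact: lebesgue_rV_cube].
Qed.

Lemma cbox_compact n (K : 'rV[R]_n * 'rV[R]_n) : compact (cbox K).
Proof.
have := @rV_compact R n (fun i => `[K.1 ord0 i, K.2 ord0 i]%classic)
  (fun i => @segment_compact _ _ _).
congr compact; apply/seteqP; split => x /= H i; have := H i; by rewrite in_itv.
Qed.

(** Open boxes are sigma-compact, hence so are their continuous images. *)
Lemma obox_bigcup_cbox n (K : 'rV[R]_n * 'rV[R]_n) :
  obox K = \bigcup_k cbox (\row_i (K.1 ord0 i + k.+1%:R^-1), \row_i (K.2 ord0 i - k.+1%:R^-1)).
Proof.
apply/seteqP; split=> x; last first.
  move=> [k _ xk] i; have := xk i; rewrite !mxE.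
  have : 0 < k.+1%:R^-1 :> R by rewrite invr_gt0.
  by move: (k.+1%:R^-1) => c c0 /andP[? ?]; apply/andP; split; lra.
move=> Kx.
have [k Pk] : exists k, forall i, k.+1%:R^-1 <= x ord0 i - K.1 ord0 i /\
    k.+1%:R^-1 <= K.2 ord0 i - x ord0 i.
  pose m i := Num.min (x ord0 i - K.1 ord0 i) (K.2 ord0 i - x ord0 i).
  have m0 i : 0 < m i by rewrite /m lt_min !subr_gt0 andbC andbC; exact: Kx.
  exists (\max_(i < n) (Num.trunc (m i)^-1))%N => i.
  suff : (\max_(i < n) (Num.trunc (m i)^-1))%N.+1%:R^-1 <= m i.
    by rewrite /m le_min => /andP[].
  rewrite -[leRHS]invrK lef_pV2 ?posrE ?invr_gt0//.
  apply: le_trans (ltW (truncnS_gt _)) _.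
  by rewrite ler_nat ltnS (leq_bigmax i).
by exists k => // i; rewrite !mxE; have := Pk i; move: (k.+1%:R^-1) => c [? ?]; apply/andP; split; lra.
Qed.

End boxes.

(** * Integration and L2 *)

Section integration.
Context d (T : measurableType d) (R : realType).
Variable mu : {measure set T -> \bar R}.
Implicit Types (D : set T) (f g : T -> R).

Lemma Rintegral_ae_eq D f g : measurable D ->
  measurable_fun D f -> measurable_fun D g ->
  {ae mu, forall x, D x -> f x = g x} ->
  \int[mu]_(x in D) f x = \int[mu]_(x in D) g x.
Proof.
move=> mD mf mg fg; congr fine; apply: ae_eq_integral => //.
- exact/measurable_EFinP.
- exact/measurable_EFinP.
- by apply: filterS fg => x /[apply] ->.
Qed.

(** Dominated convergence, for limits of identities: an identity between
    integrals written as the vanishing of one integral passes to the limit. *)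
Lemma Rintegral_limit_eq0 D (f_ : nat -> T -> R) f h : measurable D ->
  (forall n, measurable_fun D (f_ n)) -> measurable_fun D f ->
  (forall x, D x -> f_ ^~ x @ \oo --> f x) ->
  mu.-integrable D (EFin \o h) ->
  (forall n x, D x -> `|f_ n x| <= h x) ->
  (forall n, \int[mu]_(x in D) f_ n x = 0) ->
  \int[mu]_(x in D) f x = 0.
Proof.
move=> mD mf_ mf f_f ih f_h f_0.
have if_ n : mu.-integrable D (EFin \o f_ n).
  apply: le_integrable ih => //; first exact/measurable_EFinP.
  by move=> x Dx; rewrite lee_fin; apply: le_trans (f_h n x Dx) (ler_norm _).
have [||||_ _ H] := @dominated_convergence _ _ _ mu D mD (fun n => EFin \o f_ n)
  (EFin \o f) (EFin \o h) _ _ _ ih _.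
- by move=> n; exact/measurable_EFinP.
- exact/measurable_EFinP.
- by apply: aeW => x Dx; apply: cvg_EFin; [exact: nearW|exact: f_f].
- by apply: aeW => x n Dx; rewrite lee_fin; exact: f_h.
have H0 : (fun n => \int[mu]_(x in D) (EFin \o f_ n) x)%E = cst 0%E.
  apply/funext => n; rewrite -[LHS]fineK; last exact: integrable_fin_num.
  by rewrite -[X in X%:E]/(\int[mu]_(x in D) f_ n x) f_0.
rewrite H0 in H; rewrite /Rintegral.
by rewrite -(cvg_lim _ H)// lim_cst.
Qed.

End integration.

Section L2_theory.
Context (R : realType) (n : nat).
Notation mu := (lebesgue_rV R n).
Implicit Types (D S : set 'rV[R]_n) (u v w g : 'rV[R]_n -> R).

Lemma L2P D u : L2 D u <->
  measurable_fun D u /\ mu.-integrable D (fun x => (u x ^+ 2)%:E).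
Proof.
have E : (\int[mu]_(x in D) `|(u x ^+ 2)%:E|)%E = sqnorm D u.
  by apply: eq_integral => x _; rewrite gee0_abs// lee_fin sqr_ge0.
split=> -[mu_ iu]; split => //.
  apply/integrableP; split; last by rewrite E.
  by apply/measurable_EFinP; exact: measurable_funX.
by move/integrableP : iu => [_]; rewrite E.
Qed.

Lemma L2_integrableM D u v : measurable D -> L2 D u -> L2 D v ->
  mu.-integrable D (EFin \o (fun x => u x * v x)).
Proof.
move=> mD /L2P[mu_ iu] /L2P[mv iv].
apply: le_integrable (integrableD mD iu iv) => //.
  by apply/measurable_EFinP; exact: measurable_funM.
move=> x _; rewrite /= lee_fin [leRHS]ger0_norm ?addr_ge0 ?sqr_ge0//.
by rewrite ler_norml; apply/andP; split; nra.
Qed.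

Lemma L2S D S u : measurable D -> measurable S -> S `<=` D -> L2 D u -> L2 S u.
Proof.
move=> mD mS SD /L2P[mu_ iu]; apply/L2P; split.
  exact: measurable_funS mu_.
exact: integrableS iu.
Qed.

Lemma L2_le D u v : measurable D -> measurable_fun D u -> L2 D v ->
  (forall x, D x -> `|u x| <= `|v x|) -> L2 D u.
Proof.
move=> mD mu_ /L2P[mv iv] uv; apply/L2P; split => //.
apply: le_integrable iv => //.
  by apply/measurable_EFinP; exact: measurable_funX.
by move=> x Dx; rewrite lee_fin !normrX; apply: lerXn2r; rewrite ?nnegrE ?uv.
Qed.

Lemma L2D D u v : measurable D -> L2 D u -> L2 D v -> L2 D (u \+ v).
Proof.
move=> mD /[dup] /L2P[mu_ iu] Lu /[dup] /L2P[mv iv] Lv; apply/L2P; split.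
  exact: measurable_funD.
have i2 := integrableZl mD 2 (integrableD mD iu iv).
apply: le_integrable i2 => //.
  by apply/measurable_EFinP; apply: measurable_funX; exact: measurable_funD.
move=> x _; rewrite -EFinD -EFinM lee_fin [leLHS]ger0_norm ?sqr_ge0//.
rewrite [leRHS]ger0_norm; last by rewrite mulr_ge0// addr_ge0 ?sqr_ge0.
by have := sqr_ge0 (u x - v x); rewrite /=; nra.
Qed.

Lemma L2N D u : measurable D -> L2 D u -> L2 D (\- u).
Proof.
move=> mD Lu; apply: (L2_le mD _ Lu) => [|x _]; last by rewrite /= normrN.
by apply: measurableT_comp => //; case: Lu.
Qed.

Lemma L2B D u v : measurable D -> L2 D u -> L2 D v -> L2 D (u \- v).
Proof. by move=> mD Lu Lv; apply: L2D => //; exact: L2N. Qed.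

Lemma innerC D u v : inner D u v = inner D v u.
Proof. by apply: eq_Rintegral => x _; rewrite mulrC. Qed.

Lemma innerBl D u v w : measurable D -> L2 D u -> L2 D v -> L2 D w ->
  inner D (u \- v) w = inner D u w - inner D v w.
Proof.
move=> mD Lu Lv Lw; rewrite -RintegralB//; try exact: L2_integrableM.
by apply: eq_Rintegral => x _; rewrite mulrBl.
Qed.

Lemma innerBr D u v w : measurable D -> L2 D u -> L2 D v -> L2 D w ->
  inner D w (u \- v) = inner D w u - inner D w v.
Proof. by move=> *; rewrite innerC innerBl// innerC [inner D v w]innerC. Qed.

Lemma inner_ae_eq D u v w : measurable D ->
  measurable_fun D u -> measurable_fun D v -> measurable_fun D w ->
  {ae mu, forall x, D x -> u x = v x} -> inner D u w = inner D v w.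
Proof.
move=> mD mu_ mv mw uv; apply: Rintegral_ae_eq => //; try exact: measurable_funM.
by apply: filterS uv => x /[apply] ->.
Qed.

Lemma sqnorm_ae_eq D u v : measurable D ->
  measurable_fun D u -> measurable_fun D v ->
  {ae mu, forall x, D x -> u x = v x} -> sqnorm D u = sqnorm D v.
Proof.
move=> mD mu_ mv uv; apply: ae_eq_integral => //.
- by apply/measurable_EFinP; exact: measurable_funX.
- by apply/measurable_EFinP; exact: measurable_funX.
- by apply: filterS uv => x /[apply] ->.
Qed.

Lemma sqnormB0 D u : sqnorm D (u \- u) = 0%E.
Proof.
by rewrite /sqnorm integral0_eq// => x _; rewrite /= subrr expr0n.
Qed.

(** Young's inequality replaces that of Cauchy and Schwarz: it avoids square
    roots, and a suitable choice of l is as good for limit arguments. *)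
Lemma inner_le_young D g w (l : R) : measurable D -> 0 < l -> L2 D g -> L2 D w ->
  `|inner D g w| <= l * fine (sqnorm D g) + l^-1 * fine (sqnorm D w).
Proof.
move=> mD l0 Lg Lw; have /L2P[_ ig] := Lg; have /L2P[_ iw] := Lw.
apply: le_trans (le_normr_Rintegral _ _) _ => //; first exact: L2_integrableM.
have zig := integrableZl mD l ig; have ziw := integrableZl mD l^-1 iw.
rewrite -[fine (sqnorm D g)]/(\int[mu]_(x in D) (g x ^+ 2)).
rewrite -[fine (sqnorm D w)]/(\int[mu]_(x in D) (w x ^+ 2)).
rewrite -!RintegralZl// -RintegralD//; apply: le_Rintegral => //.
- by have := integrable_abse (L2_integrableM mD Lg Lw).
- exact: (integrableD mD zig ziw).
move=> x _; rewrite -(ler_pM2l l0) mulrDr [_ * (l^-1 * _)]mulrA mulfV ?gt_eqF// mul1r.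
rewrite -[l in leLHS](gtr0_norm l0) -normrM ler_norml; apply/andP; split.
  by have := sqr_ge0 (l * g x + w x); have := sqr_ge0 (l * g x);have := sqr_ge0 (w x); nra.
by have := sqr_ge0 (l * g x - w x); have := sqr_ge0 (l * g x);have := sqr_ge0 (w x); nra.
Qed.

(** The functional w |-> sum_i (g_i, w_i) + (g_0, w_0) is continuous on L2, so
    it vanishes at w as soon as it vanishes at functions arbitrarily close to w.
    The extra index 0 separates the zeroth-order term from the gradient. *)
Lemma inner_approx_eq0 D m (g w : 'I_m -> 'rV[R]_n -> R) g0 w0 : measurable D ->
  (forall i, L2 D (g i)) -> (forall i, L2 D (w i)) -> L2 D g0 -> L2 D w0 ->
  (forall e : R, 0 < e -> exists (p : 'I_m -> 'rV[R]_n -> R) p0,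
    [/\ forall i, L2 D (p i), L2 D p0,
       forall i, (sqnorm D (w i \- p i)%R < e%:E)%E, (sqnorm D (w0 \- p0)%R < e%:E)%E &
       \sum_i inner D (g i) (p i) + inner D g0 p0 = 0]) ->
  \sum_i inner D (g i) (w i) + inner D g0 w0 = 0.
Proof.
move=> mD Lg Lw Lg0 Lw0 H.
set G := \sum_i fine (sqnorm D (g i)) + fine (sqnorm D g0).
have G0 : 0 <= G.
  by rewrite addr_ge0 ?sumr_ge0// => *; rewrite fine_ge0// integral_ge0// => *; rewrite lee_fin sqr_ge0.
apply/eqP; rewrite -normr_le0; apply/ler_addgt0Pr => eta eta0; rewrite add0r.
(* the two parts of Young's bound are made at most eta / 2 each *)
pose l := eta / 2 / (G + 1).
have l0 : 0 < l by rewrite /l divr_gt0 ?divr_gt0// ltr_wpDl.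
pose e := l * (eta / 2 / m.+1%:R).
have e0 : 0 < e by rewrite /e mulr_gt0// !divr_gt0.
have [p [p0 [Lp Lp0 wp wp0 E0]]] := H e e0.
have -> : \sum_i inner D (g i) (w i) + inner D g0 w0 =
    \sum_i inner D (g i) (w i \- p i) + inner D g0 (w0 \- p0).
  under [X in _ = X + _]eq_bigr do rewrite innerBr//.
  by rewrite innerBr// sumrB addrACA -opprD E0 subr0.
have le_e q : (sqnorm D q < e%:E)%E -> fine (sqnorm D q) <= e.
  move=> qe; have q0 : (0 <= sqnorm D q)%E by apply: integral_ge0 => *; rewrite lee_fin sqr_ge0.
  by rewrite -lee_fin fineK ?ltW// ge0_fin_numE// (lt_le_trans qe)// leey.
apply: le_trans (ler_normD _ _) _; apply: (@le_trans _ _ (l * G + l^-1 * (e *+ m.+1))).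
  rewrite /G mulrDr mulr_sumr mulrSr mulrDr addrACA; apply: lerD.
    apply: le_trans (ler_norm_sum _ _ _) _.
    have -> : e *+ m = \sum_(i < m) e by rewrite sumr_const card_ord.
    rewrite mulr_sumr -big_split/=; apply: ler_sum => i _.
    apply: le_trans (inner_le_young mD l0 (Lg i) (L2B mD (Lw i) (Lp i))) _.
    by rewrite lerD2l ler_pM2l ?invr_gt0// le_e.
  apply: le_trans (inner_le_young mD l0 Lg0 (L2B mD Lw0 Lp0)) _.
  by rewrite lerD2l ler_pM2l ?invr_gt0// le_e.
have -> : l^-1 * (e *+ m.+1) = eta / 2.
  by rewrite -mulr_natr /e; field; rewrite (gt_eqF l0) addrC natr1 pnatr_eq0.
have : l * G <= eta / 2.
  rewrite /l mulrAC ler_pdivrMr ?ltr_wpDl// ler_pM2l ?divr_gt0//.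
  by rewrite lerDl.
lra.
Qed.

End L2_theory.

(** * The fundamental lemma of the calculus of variations *)

Section du_bois_reymond.
Context (R : realType) (n : nat).
Notation mu := (lebesgue_rV R n).
Implicit Types (K : 'rV[R]_n * 'rV[R]_n) (U : set 'rV[R]_n) (g : 'rV[R]_n -> R).

Lemma elementary_prod (I : Type) (s : seq I) (F : I -> 'rV[R]_n -> R) :
  (forall i, elementary (F i)) -> elementary (fun x => \prod_(i <- s) F i x).
Proof.
move=> eF; elim: s => [|i s IHs].
  by under eq_fun do rewrite big_nil; exact: Elem_cst.
by under eq_fun do rewrite big_cons; exact: Elem_mul.
Qed.

Lemma elementary_flat (i : 'I_n) (a : R) :
  elementary (fun x : 'rV[R]_n => flat 0 (x ord0 i - a)) /\
  elementary (fun x : 'rV[R]_n => flat 0 (a - x ord0 i)).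
Proof.
split.
  by have := Elem_flat 0 i 1 (- a); under eq_fun do rewrite mul1r.
by have := Elem_flat 0 i (-1) a; under eq_fun do rewrite mulN1r addrC.
Qed.

(** For p >= 0 this increases from 0 to 1 as c tends to infinity if p > 0, and
    stays 0 if p = 0: applied to a bump function it yields smooth functions that
    converge to the indicator of the set where the bump is positive. *)
Definition saturate (c p : R) : R := 1 - expR (- (c * p)).

Lemma saturate_itv c p : 0 <= c -> 0 <= p -> 0 <= saturate c p <= 1.
Proof.
move=> c0 p0; rewrite /saturate subr_ge0 expR_le1 oppr_le0 mulr_ge0//=.
Qed.

Lemma saturate0 c : saturate c 0 = 0.
Proof. by rewrite /saturate mulr0 oppr0 expR0 subrr. Qed.

(** The bump p_ may itself depend on k; this is used for the time cutoffs,
    whose supports grow with k. *)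
Lemma cvg_saturate (p_ : nat -> R) (p : R) : 0 < p -> p_ @ \oo --> p ->
  saturate k%:R (p_ k) @[k --> \oo] --> (1 : R).
Proof.
move=> p0 cp; rewrite /saturate -[X in _ --> X]subr0.
apply: cvgB; first exact: cvg_cst.
have p2p : p / 2 < p by rewrite ltr_pdivrMr// ltr_pMr// ltr1n.
apply/cvgrPdist_le => e e0; near=> k.
rewrite sub0r normrN ger0_norm ?expR_ge0// expRN.
have p2 : p / 2 <= p_ k.
  by near: k; exact: (cvgr_ge _ cp _ p2p).
have kp : e^-1 <= k%:R * p_ k.
  apply: (@le_trans _ _ (k%:R * (p / 2))); last by rewrite ler_wpM2l.
  rewrite -ler_pdivrMr ?divr_gt0//.
  by near: k; exact: nbhs_infty_ger.
rewrite -[e]invrK lef_pV2 ?posrE ?expR_gt0 ?invr_gt0//.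
apply: le_trans kp (le_trans _ (expR_ge1Dx _)).
by rewrite lerDr.
Unshelve. all: by end_near. Qed.

Lemma elementary_saturate c (f : 'rV[R]_n -> R) : elementary f ->
  elementary (fun x => saturate c (f x)).
Proof.
move=> ef; have -> : (fun x => saturate c (f x)) =
   (fun x => 1 + - 1 * expR (- c * f x)).
  by apply/funext => x; rewrite /saturate mulN1r mulNr.
apply: Elem_add; first exact: Elem_cst.
apply: Elem_mul; first exact: Elem_cst.
by apply/Elem_exp/Elem_mul => //; exact: Elem_cst.
Qed.

Definition bump K (x : 'rV[R]_n) : R :=
  \prod_(i < n) (flat 0 (x ord0 i - K.1 ord0 i) * flat 0 (K.2 ord0 i - x ord0 i)).

Lemma bump_ge0 K x : 0 <= bump K x.
Proof. by apply: prodr_ge0 => i _; rewrite mulr_ge0// flat_ge0. Qed.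

Lemma bump_gt0 K x : obox K x -> 0 < bump K x.
Proof.
move=> Kx; apply: prodr_gt0 => i _; have /andP[a b] := Kx i.
by rewrite mulr_gt0// flat_gt0 subr_gt0.
Qed.

Lemma bump_eq0 K x : ~ obox K x -> bump K x = 0.
Proof.
move=> /existsNP[i nKx]; rewrite /bump (bigD1 i)//=.
have : flat 0 (x ord0 i - K.1 ord0 i) = 0 \/ flat 0 (K.2 ord0 i - x ord0 i) = 0.
  have /negP := nKx; rewrite negb_and -!leNgt => /orP[?|?];
    [left|right]; by rewrite /flat ifF//; apply/negbTE; rewrite -leNgt subr_le0.
by case=> ->; rewrite ?mul0r ?mulr0 ?mul0r.
Qed.

Lemma elementary_bump K : elementary (bump K).
Proof.
apply: elementary_prod => i.
by apply: Elem_mul; [case: (elementary_flat i (K.1 ord0 i))|case: (elementary_flat i (K.2 ord0 i))].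
Qed.

Lemma test_fun_bump U K c : cbox K `<=` U -> test_fun U (fun x => saturate c (bump K x)).
Proof.
move=> KU; split; first exact/elementary_smooth/elementary_saturate/elementary_bump.
exists (cbox K); split=> //; first exact: cbox_compact.
move=> x nKx; rewrite bump_eq0 ?saturate0// => Kx; apply: nKx => i.
by have /andP[/ltW-> /ltW->] := Kx i.
Qed.

Lemma obox_cbox K : obox K `<=` cbox K.
Proof. by move=> x Kx i; have /andP[/ltW-> /ltW->] := Kx i. Qed.

Lemma cbox_lty K : (mu (cbox K) < +oo)%E.
Proof.
apply: lebesgue_rV_bounded; first by apply: rV_compact_measurable; exact: cbox_compact.
by apply: compact_bounded; exact: cbox_compact.
Qed.

Lemma obox_lty K : (mu (obox K) < +oo)%E.
Proof.
apply: le_lt_trans (cbox_lty K); apply: le_measure; rewrite ?inE.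
- exact: obox_measurable.
- by apply: rV_compact_measurable; exact: cbox_compact.
- exact: obox_cbox.
Qed.

Lemma L2_integrable D g : measurable D -> (mu D < +oo)%E -> L2 D g ->
  mu.-integrable D (EFin \o g).
Proof.
move=> mD muD Lg; have L1 : L2 D (cst 1).
  apply/L2P; split; first exact: measurable_cst.
  apply: (@measurable_bounded_integrable _ _ _ _ (cst (1 ^+ 2))) => //.
  exact: bounded_cst.
have := L2_integrableM mD Lg L1.
by apply: eq_integrable => // x _ /=; rewrite mulr1.
Qed.

(** Test functions only see smooth weights; letting saturated bumps increase to
    the indicator of the box gives the integral over the box. *)
Lemma Rintegral_obox_eq0 U g K : open U -> L2 U g ->
  (forall phi, test_fun U phi -> inner U g phi = 0) -> cbox K `<=` U ->
  \int[mu]_(x in obox K) g x = 0.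
Proof.
move=> oU Lg gphi KU.
have mU := rV_open_measurable oU; have mK := @obox_measurable R n K.
have oKU : obox K `<=` U by apply: subset_trans KU; exact: obox_cbox.
have LgK := L2S mU mK oKU Lg.
have iK := L2_integrable mK (obox_lty K) LgK.
have [mgK _] := LgK.
pose phi k (x : 'rV[R]_n) := saturate k%:R (bump K x).
apply: (@Rintegral_limit_eq0 _ _ _ mu _ (fun k x => g x * phi k x) g (fun x => `|g x|)) => //.
- move=> k; apply: measurable_funM => //; apply: smooth_measurable.
  by case: (@test_fun_bump U K k%:R KU).
- move=> x Kx; rewrite -[X in _ --> X]mulr1; apply: cvgM; first exact: cvg_cst.
  apply: (@cvg_saturate (cst (bump K x)) (bump K x)); last exact: cvg_cst.
  exact: bump_gt0.
- by have := integrable_abse iK.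
- move=> k x Kx; rewrite normrM ler_piMr//.
  have /andP[? ?] := saturate_itv (ler0n R k) (bump_ge0 K x).
  by rewrite ger0_norm.
- move=> k; rewrite -(gphi _ (@test_fun_bump U K k%:R KU)) /inner.
  rewrite -(setIidr oKU) Rintegral_mkcondr; apply: eq_Rintegral => x _.
  rewrite patchE; case: ifPn => // /negP; rewrite inE => nKx.
  by rewrite bump_eq0// saturate0 mulr0.
Qed.

(** The fundamental lemma of the calculus of variations. The integral of g
    vanishes on all boxes whose closure is in U, hence, inside such a box, on all
    measurable sets since boxes are a generating pi-system; so g vanishes almost
    everywhere in the box, and U is a countable union of such boxes. *)
Theorem du_bois_reymond U g : open U -> L2 U g ->
  (forall phi, test_fun U phi -> inner U g phi = 0) ->
  {ae mu, forall x, U x -> g x = 0}.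
Proof.
move=> oU Lg gphi; have mU := rV_open_measurable oU.
have box K : cbox K `<=` U -> {ae mu, forall x, obox K x -> g x = 0}.
  move=> KU; have mK := @obox_measurable R n K.
  have oKU : obox K `<=` U by apply: subset_trans KU; exact: obox_cbox.
  have LgK := L2S mU mK oKU Lg.
  have iK := L2_integrable mK (obox_lty K) LgK.
  have iS S : measurable S -> mu.-integrable (S `&` obox K) (EFin \o g).
    by move=> mS; apply: integrableS iK => //; exact: measurableI.
  have int0 S : measurable S -> (\int[mu]_(x in S `&` obox K) (g x)%:E = 0)%E.
    rewrite measurable_rV_obox.
    have fin0 D : mu.-integrable D (EFin \o g) -> \int[mu]_(x in D) g x = 0 ->
        measurable D -> (\int[mu]_(x in D) (g x)%:E = 0)%E.
      move=> iD D0 mD; rewrite -[LHS]fineK; last exact: (integrable_fin_num mD iD).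
      by rewrite -[X in X%:E]/(\int[mu]_(x in D) g x) D0.
    apply: (@dynkin_induction _ _ _ (fun S => \int[mu]_(x in S `&` obox K) (g x)%:E = 0)%E
      (measurable_rV_obox R n)).
    - move=> _ _ [L _ <-] [M _ <-]; rewrite oboxI; exact: imageT.
    - by rewrite setTI; apply: fin0 iK _ mK; apply: (Rintegral_obox_eq0 oU Lg gphi KU).
    - move=> _ [L _ <-]; apply: fin0; [by apply: iS; exact: obox_measurable| |apply: measurableI => //; exact: obox_measurable].
      rewrite oboxI; apply: Rintegral_obox_eq0 oU Lg gphi _ => x xc; apply: KU => i.
      by have := xc i; rewrite !mxE ge_max le_min => /andP[/andP[_ ->] /andP[_ ->]].
    - move=> {}S mS S0.
      have := fin0 _ iK (Rintegral_obox_eq0 oU Lg gphi KU) mK.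
      rewrite -{1}(setTI (obox K)) -(setUv S) setIUl integral_setU//.
      + by rewrite S0 add0e.
      + exact: measurableI.
      + by apply: measurableI => //; exact: measurableC.
      + rewrite -setIUl setUv setTI; exact: measurable_int iK.
      + apply/disj_set2P; rewrite setIACA setICr; exact: set0I.
    - move=> F mF tF F0; rewrite setI_bigcupl integral_bigcup//.
      + by rewrite eseries0.
      + exact: trivIset_setIr.
      + by move=> k; exact: measurableI.
      + rewrite -setI_bigcupl; apply: iS; exact: bigcupT_measurable.
  have : ae_eq mu (obox K) (EFin \o g) (cst 0%E).
    apply: integral_ae_eq => // S SK mS.
    by rewrite integral0 -(setIidl SK) int0.
  by apply: filterS => x gx Kx; have [] := gx Kx.
(* countably many negligible sets, indexed by the codes of rational boxes *)
have : {ae mu, forall x, forall k : nat,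
   forall q : 'rV[rat]_n * 'rV[rat]_n, unpickle k = Some q -> cbox (ratbox R q) `<=` U -> obox (ratbox R q) x -> g x = 0}.
  apply: ae_foralln => k; case: unpickle => [q|]; last exact: aeW.
  have [qU|nqU] := pselect (cbox (@ratbox R n q) `<=` U).
    by apply: filterS (box _ qU) => x gx _ [<-] _.
  by apply: aeW => x _ [<-].
apply: filterS => x H Ux.
have [q [qx qU]] := nbhs_ratbox (open_nbhs_nbhs (conj oU Ux)).
exact: (H (pickle q) q (pickleK q) qU qx).
Qed.

End du_bois_reymond.

(** * The integral of a derivative *)

Section integration_by_parts.
Context (R : realType).

(** The fundamental theorem of calculus on an interval whose endpoints lie
    outside the support. *)
Lemma int_derive1_eq0 (F G : R -> R) (M : R) :
  (forall t, is_derive t (1 : R) F (G t)) -> continuous G ->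
  (forall t, M <= `|t| -> F t = 0 /\ G t = 0) ->
  (\int[lebesgue_measure]_t (G t)%:E = 0)%E.
Proof.
move=> dF cG FG0.
pose N : R := `|M| + 1; have N0 : 0 < N by rewrite ltr_wpDl.
have MN t : N <= `|t| -> F t = 0 /\ G t = 0.
  by move=> Nt; apply: FG0; apply: le_trans Nt; rewrite (le_trans (ler_norm _))// lerDl.
have NN : - N < N by rewrite gtrN.
have cF : continuous F.
  by move=> t; apply/differentiable_continuous/derivable1_diffP; case: (dF t).
have E := @continuous_FTC2 R G F (- N) N NN.
have FN : F N = 0 by apply: (MN N _).1; rewrite ger0_norm// ltW.
have FnN : F (- N) = 0 by apply: (MN _ _).1; rewrite normrN ger0_norm// ltW.
have I0 : (\int[lebesgue_measure]_(t in `[(- N)%R, N]) (G t)%:E = 0)%E.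
  rewrite E ?FN ?FnN ?subee//.
  - exact: continuous_subspaceT.
  - split.
    + by move=> t _; case: (dF t).
    + by apply: cvg_at_right_filter; exact: cF.
    + by apply: cvg_at_left_filter; exact: cF.
  - by move=> t _; rewrite derive1E; case: (dF t).
rewrite -[RHS]I0 [RHS]integral_mkcond; apply: eq_integral => t _.
rewrite patchE; case: ifPn => // /negP; rewrite inE/= in_itv/= => nt.
by rewrite (MN t _).2//; apply: ltW; rewrite ltNge ler_norml; exact/negP.
Qed.

(** The difference quotients of F o s along v and of F along w coincide. This is
    applied to the embeddings of lines and hyperplanes. *)
Lemma is_derive_slice (V W : normedModType R) (s : V -> W) (F : W -> R)
    (x v : V) (w : W) (a : R) :
  (forall h : R, s (h *: v + x) = h *: w + s x) ->
  is_derive (s x) w F a -> is_derive x v (fun z => F (s z)) a.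
Proof.
move=> sE [dF <-].
have E : (fun h : R => h^-1 *: (((fun z => F (s z)) \o shift x) (h *: v) - F (s x))) =
         (fun h : R => h^-1 *: ((F \o shift (s x)) (h *: w) - F (s x))).
  by apply/funext => h; rewrite /= sE.
by split; [rewrite /derivable E|rewrite /derive E].
Qed.

Lemma continuous_rV (T : topologicalType) n (f : T -> 'rV[R]_n) :
  (forall i, continuous (fun x => f x ord0 i)) -> continuous f.
Proof.
move=> cf x A [P /= Pf PA].
have H : \forall y \near x, forall i j, P i j (f y i j).
  apply: filter_forall => i; apply: filter_forall => j.
  by rewrite (ord1 i); exact: (cf j x (P ord0 j) (Pf ord0 j)).
by apply: filterS H => y Py; exact: PA.
Qed.

Lemma continuous_snocl n (t : R) : continuous (fun x : 'rV[R]_n => snoc x t).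
Proof.
apply: continuous_rV => j; case: (unliftP ord_max j) => [i|] ->.
  by under eq_fun do rewrite snoc_lift; exact: coord_continuous.
by under eq_fun do rewrite snoc_max; exact: cst_continuous.
Qed.

Lemma continuous_snocr n (x : 'rV[R]_n) : continuous (snoc x).
Proof.
apply: continuous_rV => j; case: (unliftP ord_max j) => [i|] ->.
  by under eq_fun do rewrite snoc_lift; exact: cst_continuous.
by under eq_fun do rewrite snoc_max.
Qed.

Lemma continuous_compact_bounded n (C : set 'rV[R]_n) (f : 'rV[R]_n -> R) :
  compact C -> continuous f -> exists B, forall x, C x -> `|f x| <= B.
Proof.
move=> cC cf; have : compact (f @` C).
  by apply: continuous_compact => //; exact: continuous_subspaceT.
move=> /compact_bounded[M [_ MC]]; exists (M + 1) => x Cx.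
by apply: MC; [rewrite ltrDl|exists x].
Qed.

Lemma integrable_supp d (T : measurableType d) (mu : {measure set T -> \bar R})
    (D S : set T) (f : T -> R) (B : R) : measurable D -> measurable S -> (mu S < +oo)%E ->
  measurable_fun D f -> (forall x, D x -> `|f x| <= B) ->
  (forall x, D x -> ~ S x -> f x = 0) ->
  mu.-integrable D (EFin \o f).
Proof.
move=> mD mS muS mf fB f0.
have iS : mu.-integrable (D `&` S) (EFin \o f).
  apply: measurable_bounded_integrable.
  - exact: measurableI.
  - apply: le_lt_trans muS; apply: le_measure; rewrite ?inE//; exact: measurableI.
  - by apply: measurable_funS mf.
  - exists B; split; first exact: num_real.
    by move=> C BC x [Dx _]; exact: (le_trans (fB x Dx) (ltW BC)).
have := (integrable_restrict mu mS mD (EFin \o f)).1 iS.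
apply: eq_integrable => // x; rewrite inE => Dx.
rewrite patchE; case: ifPn => // /negP; rewrite inE => nS.
by rewrite /= f0.
Qed.

Lemma snoc_scaleDl n (x v : 'rV[R]_n) t h :
  snoc (h *: v + x) t = h *: snoc v 0 + snoc x t.
Proof.
apply/rowP => j; rewrite !mxE; case: unliftP => [i|] _; rewrite ?mxE//.
by rewrite mulr0 add0r.
Qed.

Lemma snoc_scaleDr n (x : 'rV[R]_n) (t h : R) :
  snoc x (h *: 1 + t) = h *: basis_vec R ord_max + snoc x t.
Proof.
apply/rowP => j; rewrite !mxE eqxx /=; case: unliftP => [i|] ->; rewrite ?mxE.
  by rewrite eq_sym (negbTE (neq_lift _ _)) mulr0 add0r.
by rewrite eqxx.
Qed.

Lemma snoc_basis_vec n (i : 'I_n) : snoc (basis_vec R i) 0 = basis_vec R (lift ord_max i).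
Proof.
apply/rowP => j; rewrite !mxE eqxx /=; case: unliftP => [k|] ->; rewrite ?mxE.
  by rewrite eqxx (inj_eq lift_inj).
by rewrite (negbTE (neq_lift _ _)).
Qed.

Lemma integral_rVS n (G : 'rV[R]_n.+1 -> R) : measurable_fun setT G ->
  (lebesgue_rV R n \x lebesgue_measure)%E.-integrable setT
    (fun p => (G (snoc p.1 p.2))%:E) ->
  (\int[lebesgue_rV R n.+1]_x (G x)%:E =
   \int[lebesgue_rV R n \x lebesgue_measure]_p (G (snoc p.1 p.2))%:E)%E.
Proof.
move=> mG iG.
have mEG : measurable_fun setT (EFin \o G) by exact/measurable_EFinP.
pose nu := [the measure _ _ of (lebesgue_rV R n \x lebesgue_measure)%E].
have H mphi := @integral_pushforward _ _ _ _ R _ mphi nu setT (EFin \o G) mEG.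
have := H _ (@measurable_snoc R n); rewrite preimage_setT => {}H.
exact: (H iG measurableT).
Qed.

(** By induction on the dimension. A derivative in the last coordinate
    integrates to 0 along each line, a derivative in another coordinate
    integrates to 0 on each slice of the last coordinate by induction; in both
    cases Fubini's theorem concludes. *)
Lemma int_pderiv_eq0 n (i : 'I_n) (F G : 'rV[R]_n -> R) (M : R) :
  (forall x, is_derive x (basis_vec R i) F (G x)) -> continuous G ->
  (forall x, ~ obox (cube n M) x -> F x = 0 /\ G x = 0) ->
  (\int[lebesgue_rV R n]_x (G x)%:E = 0)%E.
Proof.
elim: n i F G => [[]//|n IHn] i F G dF cG FG0.
(* the recursive definition only provides a measure; Fubini's theorem wants
   the sigma-finite structure on the same function *)
have sf := @sigma_finite_lebesgue_rV R n.
pose H2 := isSFinite.Build _ _ _ _ (sfinite_measure_sigma_finite sf).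
pose H3 := isSigmaFinite.Build _ _ _ _ sf.
pose mn := HB.pack_for (SigmaFiniteMeasure.type _ R) (Measure.sort (lebesgue_rV R n)) H2 H3.
pose s (p : 'rV[R]_n * R) := snoc p.1 p.2.
pose G2 := fun p => (G (s p))%:E.
have mG := rV_continuous_measurable cG.
have mG2 : measurable_fun setT G2.
  apply/measurable_EFinP; apply: measurableT_comp => //; exact: measurable_snoc.
have [B GB] : exists B, forall x, `|G x| <= B.
  have [B GB] := continuous_compact_bounded (@cbox_compact _ _ (cube n.+1 M)) cG.
  exists `|B| => x; have [xM|nxM] := pselect (obox (cube n.+1 M) x).
    by apply: le_trans (GB x (@obox_cbox _ _ _ x xM)) (ler_norm _).
  by rewrite (FG0 x nxM).2 normr0.
have iG2 : (mn \x lebesgue_measure)%E.-integrable setT G2.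
  apply: (@integrable_supp _ _ (mn \x lebesgue_measure)%E setT
    (obox (cube n M) `*` `]- M, M[%classic) (fun p => G (s p)) B) => //.
  - apply: measurableX => //; exact: obox_measurable.
  - by rewrite -snoc_cube; exact: (@lebesgue_rV_cube R n.+1 M).
  - by apply: measurableT_comp => //; exact: measurable_snoc.
  - move=> p _; rewrite -snoc_cube => np; exact: (FG0 _ np).2.
suff I0 : (\int[mn \x lebesgue_measure]_p G2 p = 0)%E.
  by rewrite (integral_rVS mG iG2); exact: I0.
have slice0 x t : ~ obox (cube n M) x \/ M <= `|t| -> F (snoc x t) = 0 /\ G (snoc x t) = 0.
  move=> xt; apply: FG0 => /cubeP H; case: xt => [|].
    by apply; apply/cubeP => j; have := H (lift ord_max j); rewrite snoc_lift.
  by have := H ord_max; rewrite snoc_max leNgt => ->.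
case: (unliftP ord_max i) dF => [j|] -> dF.
  rewrite -integral21_prod_meas1//; apply: integral0_eq => t _.
  apply: (IHn j (fun x => F (snoc x t)) (fun x => G (snoc x t))).
  - move=> x; apply: (@is_derive_slice _ _ (fun z => snoc z t) F x _ (basis_vec R (lift ord_max j))) => // h.
    by rewrite snoc_scaleDl snoc_basis_vec.
  - by move=> x; apply: (@continuous_comp _ _ _ (fun z => snoc z t) G); [exact: continuous_snocl|exact: cG].
  - by move=> x nx; apply: slice0; left.
rewrite -integral12_prod_meas1//; apply: integral0_eq => x _.
apply: (@int_derive1_eq0 (fun t => F (snoc x t)) (fun t => G (snoc x t)) M).
- move=> t; apply: (@is_derive_slice _ _ (snoc x) F t _ (basis_vec R ord_max)) => // h.
  exact: snoc_scaleDr.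
- by move=> t; apply: (@continuous_comp _ _ _ (snoc x) G); [exact: continuous_snocr|exact: cG].
- by move=> t Mt; apply: slice0; right.
Qed.

End integration_by_parts.

(** * Test functions and weak derivatives *)

Section test_functions.
Context (R : realType) (n : nat).
Notation mu := (lebesgue_rV R n).
Implicit Types (U C : set 'rV[R]_n) (phi psi u g h : 'rV[R]_n -> R).

Lemma continuous_supp_integrable U C phi : measurable U -> compact C ->
  continuous phi -> (forall x, ~ C x -> phi x = 0) ->
  mu.-integrable U (EFin \o phi).
Proof.
move=> mU cC cphi phi0; have [B phiB] := continuous_compact_bounded cC cphi.
apply: (@integrable_supp _ _ _ mu U C phi `|B|) => //.
- exact: rV_compact_measurable.
- apply: lebesgue_rV_bounded; first exact: rV_compact_measurable.
  exact: compact_bounded.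
- by apply: measurable_funTS; exact: rV_continuous_measurable.
- move=> x _; have [Cx|nCx] := pselect (C x).
    exact: le_trans (phiB x Cx) (ler_norm _).
  by rewrite phi0// normr0.
- by move=> x _; exact: phi0.
Qed.

Lemma pderiv_eq0 C phi i : compact C -> (forall x, ~ C x -> phi x = 0) ->
  forall x, ~ C x -> pderiv i phi x = 0.
Proof.
move=> cC phi0 x nCx; rewrite /pderiv (@near_eq_derive _ _ _ phi (cst 0))//.
  exact: derive_cst.
have oC : open (~` C).
  apply: closed_openC; have hT : hausdorff_space 'rV[R]_n by exact: norm_hausdorff.
  exact: compact_closed hT cC.
by apply: filterS (open_nbhs_nbhs (conj oC nCx)) => y; exact: phi0.
Qed.

Lemma test_fun_pderiv U phi i : test_fun U phi -> test_fun U (pderiv i phi).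
Proof.
move=> [sphi [C [cC CU phi0]]]; split; first exact: smooth_pderiv.
by exists C; split => //; exact: pderiv_eq0 phi0.
Qed.

Lemma test_fun_L2 U phi : measurable U -> test_fun U phi -> L2 U phi.
Proof.
move=> mU [sphi [C [cC CU phi0]]]; apply/L2P; split; first exact: smooth_measurable.
apply: (@continuous_supp_integrable U C (fun x => phi x ^+ 2)) => //.
  have := smooth_continuous (smoothM sphi sphi).
  by under eq_fun do rewrite -expr2.
by move=> x nCx; rewrite phi0// expr0n.
Qed.

(** The product rule, and the vanishing of the integral of the derivative of
    phi * psi, which has compact support although phi need not. *)
Lemma inner_by_parts U phi psi i : open U -> smooth phi -> test_fun U psi ->
  inner U phi (pderiv i psi) = - inner U (pderiv i phi) psi.
Proof.
move=> oU sphi [spsi [C [cC CU psi0]]]; have mU := rV_open_measurable oU.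
have sdphi := smooth_pderiv i sphi; have sdpsi := smooth_pderiv i spsi.
have dpsi0 := pderiv_eq0 i cC psi0.
have i1 : mu.-integrable U (EFin \o (fun x => phi x * pderiv i psi x)).
  apply: (continuous_supp_integrable mU cC).
    exact/smooth_continuous/smoothM.
  by move=> x nCx; rewrite dpsi0// mulr0.
have i2 : mu.-integrable U (EFin \o (fun x => pderiv i phi x * psi x)).
  apply: (continuous_supp_integrable mU cC).
    exact/smooth_continuous/smoothM.
  by move=> x nCx; rewrite psi0// mulr0.
apply/eqP; rewrite -addr_eq0 /inner -RintegralD//.
pose G x := phi x * pderiv i psi x + pderiv i phi x * psi x.
have [M CM] := bounded_cube (compact_bounded cC).
rewrite Rintegral_mkcond /Rintegral.
have G0 : (\int[mu]_x (G x)%:E = 0)%E.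
  apply: (@int_pderiv_eq0 R n i (fun x => phi x * psi x) G M).
  - move=> x; have dphi := derivableP (@smooth_derivable R n phi i x sphi).
    have dpsi := derivableP (@smooth_derivable R n psi i x spsi).
    have dM := is_deriveM dphi dpsi; apply: is_derive_ext dM _ _ => //.
    by rewrite /G /GRing.scale /= [psi x * _]mulrC.
  - move=> x; have c1 := smooth_continuous (smoothM sphi sdpsi).
    have c2 := smooth_continuous (smoothM sdphi spsi).
    exact: continuousD (c1 x) (c2 x).
  - move=> x nxM; have nCx : ~ C x by move=> /CM.
    by rewrite /G psi0// dpsi0// !mulr0 addr0.
apply/eqP; rewrite -[RHS](congr1 fine G0); congr fine; apply: eq_integral => x _.
rewrite patchE; case: ifPn => // /negP; rewrite inE => nUx.
have nCx : ~ C x by move=> /CU.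
by rewrite /G psi0// dpsi0// !mulr0 addr0.
Qed.

Lemma test_fun_wderiv U phi i : open U -> test_fun U phi ->
  is_wderiv U i phi (pderiv i phi).
Proof.
move=> oU tphi; have mU := rV_open_measurable oU; split.
  exact/(test_fun_L2 mU)/test_fun_pderiv.
by move=> psi tpsi; apply: inner_by_parts => //; case: tphi.
Qed.

Lemma wderivP U i u : has_wderiv U i u -> is_wderiv U i u (wderiv U i u).
Proof. by move=> [g ug]; apply: (xgetPex (cst 0)); exists g. Qed.

(** Two weak derivatives have the same inner product with every test function. *)
Lemma wderiv_unique U i u g h : open U -> is_wderiv U i u g -> is_wderiv U i u h ->
  {ae mu, forall x, U x -> g x = h x}.
Proof.
move=> oU [Lg ug] [Lh uh]; have mU := rV_open_measurable oU.
have gh0 : {ae mu, forall x, U x -> (g \- h) x = 0}.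
  apply: (du_bois_reymond oU (L2B mU Lg Lh)) => phi tphi.
  rewrite innerBl//; last exact: test_fun_L2.
  by apply/eqP; rewrite subr_eq0 -eqr_opp -ug// -uh.
by apply: filterS gh0 => x gh Ux; apply/eqP; rewrite -subr_eq0; apply/eqP/gh.
Qed.

Lemma test_fun_has_wderiv U phi i : open U -> test_fun U phi -> has_wderiv U i phi.
Proof. by move=> oU tphi; exists (pderiv i phi); exact: test_fun_wderiv. Qed.

Lemma wderiv_test_fun U phi i : open U -> test_fun U phi ->
  {ae mu, forall x, U x -> wderiv U i phi x = pderiv i phi x}.
Proof.
move=> oU tphi; have w := test_fun_wderiv i oU tphi.
exact: (wderiv_unique oU (wderivP (ex_intro _ _ w)) w).
Qed.

Lemma sqnorm_wderiv_test_fun U phi i : open U -> test_fun U phi ->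
  sqnorm U (wderiv U i phi \- pderiv i phi) = 0%E.
Proof.
move=> oU tphi; have mU := rV_open_measurable oU.
have [[m1 _] _] := wderivP (test_fun_has_wderiv i oU tphi).
have [[m2 _] _] := test_fun_wderiv i oU tphi.
rewrite -(@sqnormB0 R _ U (cst 0)); apply: sqnorm_ae_eq => //.
- exact: measurable_funB.
- by apply: measurable_funB; exact: measurable_cst.
by apply: filterS (wderiv_test_fun i oU tphi) => z e Uz /=; rewrite e// !subrr.
Qed.

Lemma smooth_bounded_L2 U phi : measurable U -> bounded_set U -> smooth phi -> L2 U phi.
Proof.
move=> mU bU sphi; apply/L2P; split; first exact: smooth_measurable.
have sq : smooth (fun x => phi x ^+ 2).
  by have := smoothM sphi sphi; under eq_fun do rewrite -expr2.
have [M UM] := bounded_cube bU.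
have [B phiB] := continuous_compact_bounded (@cbox_compact R n (cube n M)) (smooth_continuous sq).
apply: measurable_bounded_integrable => //.
- exact: lebesgue_rV_bounded.
- exact: smooth_measurable.
- exists B; split; first exact: num_real.
  by move=> D BD x /UM /obox_cbox /phiB xB; exact: (le_trans xB (ltW BD)).
Qed.

End test_functions.

(** * The space-time cylinder *)

Section space_time_theory.
Context (R : realType) (d : nat).
Context (Omega : set 'rV[R]_d) (T : R).
Context (oO : open Omega) (bO : bounded_set Omega).
Notation X := 'rV[R]_d.+1.
Notation Q := (cylinder Omega T).
Notation mu := (lebesgue_rV R d.+1).

Lemma continuous_xpart : continuous (@xpart R d).
Proof.
apply: continuous_rV => i; under eq_fun do rewrite mxE.
exact: coord_continuous.
Qed.

Lemma continuous_tpart : continuous (@tpart R d).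
Proof. exact: coord_continuous. Qed.

Lemma open_cylinder : open Q.
Proof.
have -> : Q = (@xpart R d) @^-1` Omega `&` (@tpart R d) @^-1` `]0, T[%classic.
  by apply/seteqP; split=> z /=; rewrite in_itv.
apply: openI; apply: open_comp => //.
- by move=> z _; exact: continuous_xpart.
by move=> z _; exact: continuous_tpart.
Qed.

Lemma cylinder_cube : exists M, Q `<=` obox (cube d.+1 M).
Proof.
have [M OM] := bounded_cube bO; exists (Num.max M (T + 1)) => z [Oz tz].
apply/cubeP => j; case: (unliftP ord_max j) => [i|] ->.
  by have /cubeP/(_ i) := OM _ Oz; rewrite mxE lt_max => ->.
rewrite lt_max; apply/orP; right; move: tz => /andP[t0 tT].
by rewrite -/(tdir d) -/(tpart z) gtr0_norm// (lt_trans tT)// ltrDl.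
Qed.

Lemma bounded_cylinder : bounded_set Q.
Proof.
have [M QM] := cylinder_cube.
have [N [Nr cN]] := compact_bounded (@cbox_compact R _ (cube d.+1 M)).
by exists N; split=> // x Nx z /QM /obox_cbox; exact: cN.
Qed.

Let intO : interior Omega = Omega.
Proof. exact: (interior_id Omega).1. Qed.

Let mQ : measurable Q := rV_open_measurable open_cylinder.

Lemma gradx_L2 u i : has_wderiv Q (xdir i) u -> L2 Q (gradx Q u i).
Proof. by move=> /wderivP[]. Qed.

Lemma dt_L2 u : has_wderiv Q (tdir d) u -> L2 Q (dt Q u).
Proof. by move=> /wderivP[]. Qed.

(** A test function is its own smooth approximation in the definitions of the
    lateral and temporal zero traces, and its support avoids both boundaries. *)
Lemma test_fun_V1_0top phi : test_fun Q phi -> V1_0top Omega T phi.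
Proof.
move=> tphi; have [sphi [C [cC CQ phi0]]] := tphi.
have hw i : has_wderiv Q i phi.
  exact: test_fun_has_wderiv open_cylinder tphi.
split=> //.
- split=> //; first exact: test_fun_L2.
  move=> e e0; exists phi; split => //.
  + move=> z [[cz nz] tz]; have nCz : ~ C z.
      by move=> /CQ[Oz _]; apply: nz; rewrite intO.
    have oC : open (~` C).
      apply: closed_openC; have hT : hausdorff_space X by exact: norm_hausdorff.
      exact: compact_closed hT cC.
    by apply: filterS (open_nbhs_nbhs (conj oC nCz)) => y; exact: phi0.
  + by rewrite sqnormB0 lte_fin.
  + by move=> i; rewrite (sqnorm_wderiv_test_fun _ open_cylinder tphi) lte_fin.
- split.
  + apply/L2P; split; first exact: measurable_cst.
    by under eq_fun do rewrite expr0n; exact: integrable0.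
  + move=> e e0; exists phi; split => //.
    * by rewrite sqnormB0 lte_fin.
    * by rewrite (sqnorm_wderiv_test_fun _ open_cylinder tphi) lte_fin.
    * rewrite /sqnorm integral0_eq ?lte_fin// => x Ox.
      rewrite phi0 ?subrr ?expr0n// => /CQ[_].
      by rewrite /tpart /tdir snoc_max ltxx andbF.
Qed.

(** The heat equation in the strong sense, from the weak formulation restricted
    to test functions. *)
Theorem weak_solution_ae (f u : X -> R) : L2 Q f -> weak_solution Omega T f (cst 0) u ->
  (exists g, is_laplx Q u g) -> has_wderiv Q (tdir d) u ->
  {ae mu, forall z, Q z -> dt Q u z - laplx Q u z = f z}.
Proof.
move=> Lf [[Lu hwx _] weak] hl hwt.
have [Ll lapl] : is_laplx Q u (laplx Q u) by apply: (xgetPex (cst 0)).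
have [Lt ut] := wderivP hwt.
have Lh := L2B mQ (L2B mQ Lt Ll) Lf.
suff h0 : {ae mu, forall z, Q z -> (dt Q u \- laplx Q u \- f) z = 0}.
  by apply: filterS h0 => z h Qz; apply/eqP; rewrite -subr_eq0; apply/eqP/h.
apply: (du_bois_reymond open_cylinder Lh) => phi tphi.
have Lphi := test_fun_L2 mQ tphi.
have hwphi i : has_wderiv Q i phi.
  exact: test_fun_has_wderiv open_cylinder tphi.
rewrite innerBl//; last exact: L2B.
rewrite innerBl//.
have := weak phi (test_fun_V1_0top tphi).
have -> : inner Omega (cst 0) (time_trace Omega T 0 phi) = 0.
  rewrite /inner /Rintegral; under eq_integral do rewrite mul0r.
  by rewrite integral0.
have -> : inner Q u (dt Q phi) = - inner Q (dt Q u) phi.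
  rewrite -(ut phi tphi) innerC [RHS]innerC; apply: inner_ae_eq => //.
  - by case: (dt_L2 (hwphi (tdir d))).
  - by apply: smooth_measurable; apply: smooth_pderiv; case: tphi.
  - by case: Lu.
  - exact: wderiv_test_fun open_cylinder tphi.
have -> : \sum_(i < d) inner Q (gradx Q u i) (gradx Q phi i) = - inner Q (laplx Q u) phi.
  rewrite -(lapl phi tphi); apply: eq_bigr => i _.
  rewrite innerC [RHS]innerC; apply: inner_ae_eq => //.
  - by case: (gradx_L2 (hwphi (xdir i))).
  - by apply: smooth_measurable; apply: smooth_pderiv; case: tphi.
  - by case: (gradx_L2 (hwx i)).
  - exact: wderiv_test_fun open_cylinder tphi.
by move=> E; lra.
Qed.

(** Supported in 1/(k+1) <= t <= T - 1/(k+1) and converging to 1 for 0 < t < T.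
    It depends on time only, so that it commutes with spatial derivatives. *)
Definition time_cutoff (k : nat) (z : X) : R :=
  saturate k%:R (flat 0 (tpart z - k.+1%:R^-1) * flat 0 (T - k.+1%:R^-1 - tpart z)).

Lemma elementary_time_cutoff k : elementary (time_cutoff k).
Proof.
apply: elementary_saturate; apply: Elem_mul.
  by have [e _] := elementary_flat (tdir d) (k.+1%:R^-1 : R).
by have [_ e] := elementary_flat (tdir d) (T - k.+1%:R^-1).
Qed.

Lemma time_cutoff_itv k z : 0 <= time_cutoff k z <= 1.
Proof. by apply: saturate_itv => //; rewrite mulr_ge0// flat_ge0. Qed.

Lemma time_cutoff_eq0 k z : tpart z <= k.+1%:R^-1 \/ T - k.+1%:R^-1 <= tpart z ->
  time_cutoff k z = 0.
Proof.
move=> tz; rewrite /time_cutoff.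
have : flat 0 (tpart z - k.+1%:R^-1) = 0 \/ flat 0 (T - k.+1%:R^-1 - tpart z) = 0.
  by case: tz => tz; [left|right]; rewrite /flat ifF//; apply/negbTE; rewrite -leNgt subr_le0.
by case=> ->; rewrite ?mul0r ?mulr0 saturate0.
Qed.

Lemma cvg_time_cutoff z : 0 < tpart z < T -> time_cutoff k z @[k --> \oo] --> (1 : R).
Proof.
move=> /andP[t0 tT]; apply: (@cvg_saturate R (fun k => _) (flat 0 (tpart z) * flat 0 (T - tpart z))).
  by rewrite mulr_gt0// flat_gt0// subr_gt0.
have c0 := @cvg_harmonic R.
apply: cvgM; apply: continuous_cvg; try exact: flat_continuous.
  by rewrite -[X in _ --> X]subr0; apply: cvgB => //; exact: cvg_cst.
apply: cvgB; last exact: cvg_cst.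
by rewrite -[X in _ --> X]subr0; apply: cvgB => //; exact: cvg_cst.
Qed.

Lemma pderiv_time_cutoff k i z : pderiv (xdir i) (time_cutoff k) z = 0.
Proof.
rewrite /pderiv /derive; apply: cvg_lim => //; apply: cvg_near_cst.
apply: nearW => h.
have tE : tpart (h *: basis_vec R (xdir i) + z) = tpart z.
  by rewrite /tpart !mxE eqxx /= (negbTE (neq_lift _ _)) mulr0 add0r.
by rewrite /= /time_cutoff tE subrr scaler0.
Qed.

(** The factor phi is arbitrary outside Q, hence the restriction; no smoothness is
    lost when phi vanishes near the lateral boundary, because the product then
    vanishes near every boundary point of Q. *)
Definition cutoff_fun k (phi : X -> R) (z : X) : R :=
  if z \in Q then time_cutoff k z * phi z else 0.

(** A point outside Q has a time where the cutoff vanishes nearby, or lies on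
    the lateral boundary, where phi vanishes nearby, or has its spatial part in
    the exterior of Omega. *)
Lemma cutoff_fun_near0 k phi z :
  (forall z, lateral Omega T z -> \forall y \near z, phi y = 0) ->
  ~ Q z -> \forall y \near z, cutoff_fun k phi y = 0.
Proof.
move=> phi0 nQz; rewrite /cutoff_fun.
have k0 : 0 < k.+1%:R^-1 :> R by rewrite invr_gt0.
have [t0|t0] := leP (tpart z) 0.
  have H : nbhs z (@tpart R d @^-1` [set t | t < k.+1%:R^-1]).
    by apply: continuous_tpart; apply: lt_nbhsl; exact: le_lt_trans k0.
  apply: filterS H => y yk; case: ifP => // _.
  by rewrite time_cutoff_eq0 ?mul0r//; left; apply: ltW.
have [tT|tT] := leP T (tpart z).
  have H : nbhs z (@tpart R d @^-1` [set t | T - k.+1%:R^-1 < t]).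
    apply: continuous_tpart; apply: lt_nbhsr; apply: lt_le_trans tT.
    by rewrite gtrBl.
  apply: filterS H => y yk; case: ifP => // _.
  by rewrite time_cutoff_eq0 ?mul0r//; right; apply: ltW.
have nOz : ~ Omega (xpart z) by move=> Oz; apply: nQz; rewrite /= /cylinder/= t0.
have [cz|ncz] := pselect (closure Omega (xpart z)).
  have lz : lateral Omega T z.
    split; last by rewrite t0.
    by split => //; rewrite intO.
  by apply: filterS (phi0 z lz) => y ->; rewrite mulr0 if_same.
have oC : open ((@xpart R d) @^-1` (~` closure Omega)).
  apply: open_comp; first by move=> ? _; exact: continuous_xpart.
  by apply: closed_openC; exact: closed_closure.
apply: filterS (open_nbhs_nbhs (conj oC ncz)) => y ny.
by case: ifP => //; rewrite inE => -[Oy _]; case: ny; exact: subset_closure.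
Qed.

Lemma cutoff_fun_near k phi z : Q z ->
  \forall y \near z, cutoff_fun k phi y = time_cutoff k y * phi y.
Proof.
move=> Qz; apply: filterS (open_nbhs_nbhs (conj open_cylinder Qz)) => y Qy.
by rewrite /cutoff_fun mem_set.
Qed.

Lemma test_fun_cutoff k phi : smooth phi ->
  (forall z, lateral Omega T z -> \forall y \near z, phi y = 0) ->
  test_fun Q (cutoff_fun k phi).
Proof.
move=> sphi phi0; split.
  apply: smooth_local => z; have [Qz|nQz] := pselect (Q z).
    exists (fun z => time_cutoff k z * phi z); last exact: cutoff_fun_near.
    by apply: smoothM => //; apply: elementary_smooth; exact: elementary_time_cutoff.
  by exists (cst 0); [exact: smooth_cst|exact: cutoff_fun_near0].
pose S := [set z | cutoff_fun k phi z <> 0].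
have SQ : S `<=` Q.
  by move=> z; rewrite /S /= /cutoff_fun; case: ifP => //; rewrite inE.
exists (closure S); split.
- have [M QM] := cylinder_cube.
  have cM := @cbox_compact R _ (cube d.+1 M).
  have hT : hausdorff_space X by exact: norm_hausdorff.
  apply: (subclosed_compact _ cM); first exact: closed_closure.
  have clM : closed (cbox (cube d.+1 M)) by exact: compact_closed hT cM.
  rewrite [X in _ `<=` X](closure_id _).1//; apply: closure_subset.
  by move=> z /SQ/QM/obox_cbox.
- move=> z Sz; apply: contrapT => nQz.
  have [y [Sy y0]] := Sz _ (cutoff_fun_near0 k phi0 nQz).
  exact: Sy.
- by move=> z nSz; apply: contrapT => nz; apply: nSz; exact: subset_closure.
Qed.

Lemma pderiv_cutoff k i phi z : smooth phi -> Q z ->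
  pderiv (xdir i) (cutoff_fun k phi) z = time_cutoff k z * pderiv (xdir i) phi z.
Proof.
move=> sphi Qz.
have scut := elementary_smooth (elementary_time_cutoff k).
rewrite {1}/pderiv (near_eq_derive _ (cutoff_fun_near k phi Qz)).
have dcut := derivableP (@smooth_derivable R _ _ (xdir i) z scut).
have dphi := derivableP (@smooth_derivable R _ _ (xdir i) z sphi).
have [_ ->] := is_deriveM dcut dphi.
rewrite -!/(pderiv _ _ _) pderiv_time_cutoff.
by rewrite scaler0 addr0.
Qed.

(** For fixed k the identity with the weight [time_cutoff k] holds for the smooth
    approximations of v, as they become test functions, and passes to v by
    [inner_approx_eq0]; the weight is then removed by dominated convergence. *)
Theorem green_formula (q : 'I_d -> X -> R) (g v : X -> R) :
  (forall i, L2 Q (q i)) -> is_wdivx Q q g -> V10_0 Omega T v ->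
  \sum_(i < d) inner Q (q i) (gradx Q v i) + inner Q g v = 0.
Proof.
move=> Lq [Lg qg] [Lv hv v0].
have Lgv i := gradx_L2 (hv i).
have mcut k D : measurable_fun D (time_cutoff k).
  by apply: smooth_measurable; apply: elementary_smooth; exact: elementary_time_cutoff.
have Lcut k w : L2 Q w -> L2 Q (fun z => time_cutoff k z * w z).
  move=> Lw; apply: (L2_le mQ _ Lw).
    by apply: measurable_funM => //; case: Lw.
  move=> z _; have /andP[c0 c1] := time_cutoff_itv k z.
  by rewrite normrM (ger0_norm c0) ler_piMl.
have cut0 k : \sum_(i < d) inner Q (fun z => time_cutoff k z * q i z) (gradx Q v i) +
    inner Q (fun z => time_cutoff k z * g z) v = 0.
  apply: (inner_approx_eq0 mQ) => //; [by move=> i; exact: Lcut|exact: Lcut|].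
  move=> e e0; have [phi [sphi phi0 vphi dvphi]] := v0 e e0.
  exists (fun i => pderiv (xdir i) phi), phi; split => //.
  - by move=> i; apply: smooth_bounded_L2 => //; [exact: bounded_cylinder|exact: smooth_pderiv].
  - by apply: smooth_bounded_L2 => //; exact: bounded_cylinder.
  have := qg _ (test_fun_cutoff k sphi phi0).
  have -> : inner Q g (cutoff_fun k phi) = inner Q (fun z => time_cutoff k z * g z) phi.
    by apply: eq_Rintegral => z Qz; rewrite /cutoff_fun Qz mulrCA mulrA.
  move=> H; apply/eqP; rewrite addr_eq0; apply/eqP; rewrite -H.
  apply: eq_bigr => i _; apply: eq_Rintegral => z; rewrite inE => Qz.
  by rewrite pderiv_cutoff// mulrCA mulrA.
pose h z := \sum_(i < d) q i z * gradx Q v i z + g z * v z.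
have iqv i : mu.-integrable Q (EFin \o (fun z => q i z * gradx Q v i z)).
  exact: L2_integrableM.
have igv : mu.-integrable Q (EFin \o (fun z => g z * v z)) by exact: L2_integrableM.
have isum (r : seq 'I_d) F : (forall i, mu.-integrable Q (EFin \o F i)) ->
    mu.-integrable Q (EFin \o (fun z => \sum_(i <- r) F i z)) /\
    \int[mu]_(z in Q) (\sum_(i <- r) F i z) = \sum_(i <- r) \int[mu]_(z in Q) F i z.
  move=> iF; elim: r => [|i r [IH1 IH2]].
    under eq_fun do rewrite big_nil; rewrite big_nil; split; first exact: integrable0.
    by rewrite /Rintegral integral0.
  under eq_fun do rewrite big_cons; rewrite big_cons; split.
    exact: (integrableD mQ (iF i) IH1).
  by rewrite RintegralD// IH2.
have [is1 is2] := isum (index_enum _) _ iqv.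
have ih : mu.-integrable Q (EFin \o h) by exact: (integrableD mQ is1 igv).
have mh : measurable_fun Q h by apply/measurable_EFinP; exact: measurable_int ih.
rewrite /inner -is2 -RintegralD//.
apply: (@Rintegral_limit_eq0 _ _ _ mu Q (fun k z => time_cutoff k z * h z) h (fun z => `|h z|)) => //.
- by move=> k; exact: measurable_funM.
- move=> z [_ tz]; rewrite -[X in _ --> X]mul1r; apply: cvgM; last exact: cvg_cst.
  exact: cvg_time_cutoff.
- by have := integrable_abse ih.
- move=> k z _; have /andP[c0 c1] := time_cutoff_itv k z.
  by rewrite normrM (ger0_norm c0) ler_piMl.
move=> k; rewrite -[RHS](cut0 k).
have iq' i : mu.-integrable Q (EFin \o (fun z => (time_cutoff k z * q i z) * gradx Q v i z)).
  by apply: L2_integrableM => //; exact: Lcut.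
have ig' : mu.-integrable Q (EFin \o (fun z => (time_cutoff k z * g z) * v z)).
  by apply: L2_integrableM => //; exact: Lcut.
have [is1' is2'] := isum (index_enum _) _ iq'.
rewrite /inner -is2' -RintegralD//; apply: eq_Rintegral => z _.
rewrite /h mulrDr mulr_sumr mulrA; congr (_ + _).
by apply: eq_bigr => i _; rewrite mulrA.
Qed.

End space_time_theory.

(** * Mesh elements *)

Section elements.
Context (R : realType) (n : nat).
Notation X := 'rV[R]_n.

(** Elements are images of cells under a map about which nothing is known
    outside the unit cube, hence the interest of this inclusion. *)
Lemma grid_unit_box p (Xi : 'I_n -> seq R) (K : X * X) :
  (forall i, open_knot_vector p (Xi i)) -> grid Xi K -> obox K `<=` obox (@unit_box R n).
Proof.
move=> oXi gK x Kx i; have [Xi1 Xi2 _ _] := gK i; have [_ /allP XiP _ _ _] := oXi i.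
have /andP[a0 _] := XiP _ Xi1; have /andP[_ b1] := XiP _ Xi2.
have /andP[ax xb] := Kx i; rewrite !mxE.
by rewrite (le_lt_trans a0 ax) (lt_le_trans xb b1).
Qed.

Lemma spline_space_unit_box p S (Khat : set (X * X)) : spline_space p S Khat ->
  forall K, Khat K -> obox K `<=` obox (@unit_box R n).
Proof.
case=> [Xi oXi|Xi w oXi _|L Xi marked [oXi _ _ _ _]] K.
- exact: grid_unit_box.
- exact: grid_unit_box.
- by move=> [l [lL gK _ _]]; apply: (@grid_unit_box p (Xi l)) => // i; exact: oXi.
Qed.

Lemma measurable_image_obox m (F : X -> 'rV[R]_m) K : continuous F ->
  measurable (F @` obox K).
Proof.
move=> cF; rewrite obox_bigcup_cbox image_bigcup; apply: bigcupT_measurable => k.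
apply: rV_compact_measurable; apply: continuous_compact; last exact: cbox_compact.
exact: continuous_subspaceT.
Qed.

(** On a cell the geometry map agrees with a map that is continuous on the whole
    space, which transports sigma-compactness from the cell to the element. *)
Lemma geometry_map_element (Khat : set (X * X)) Q Phi K :
  geometry_map Khat Q Phi -> Khat K -> obox K `<=` obox (@unit_box R n) ->
  measurable (Phi @` obox K) /\ Phi @` obox K `<=` Q.
Proof.
move=> [[fPhi _ _] _ gK] KK KU; split; last first.
  by move=> _ [x Kx <-]; apply: fPhi; exact: KU.
have [F [G [sF _ FP]]] := gK K KK.
have -> : Phi @` obox K = F @` obox K.
  by apply: eq_imagel => x Kx; rewrite (FP x Kx).1.
apply: measurable_image_obox; apply: continuous_rV => i.
exact: smooth_continuous.
Qed.

End elements.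

(** * Consistency *)

Theorem lemma4p5 (R : realType) (d : nat) (Omega : set 'rV[R]_d) (T : R)
    (p : nat) (Shat : set ('rV[R]_d.+1 -> R))
    (Khat : set ('rV[R]_d.+1 * 'rV[R]_d.+1)) (Phi : 'rV[R]_d.+1 -> 'rV[R]_d.+1)
    (theta : 'rV[R]_d.+1 * 'rV[R]_d.+1 -> R) (f u : 'rV[R]_d.+1 -> R) :
  (1 <= d <= 3)%N ->
  bounded_lipschitz_domain Omega ->
  0 < T ->
  (2 <= p)%N ->
  spline_space p Shat Khat ->
  geometry_map Khat (cylinder Omega T) Phi ->
  (forall K, Khat K -> 0 < theta K) ->
  L2 (cylinder Omega T) f ->
  weak_solution Omega T f (cst 0) u ->
  VD1_0bot Omega T u ->
  forall vh, V0h Omega T Phi Shat vh ->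
    a_loc Omega T Khat Phi theta u vh = l_loc Omega T Khat Phi theta f vh.
Proof.
move=> _ [oO _ _ bO _] _ _ spl geo _ Lf weak [[[Lu hwx _] hl hwt] _] v [_ [v10 hvt _]].
have mQ := rV_open_measurable (@open_cylinder _ _ Omega T oO).
have [Ll lapl] : is_laplx (cylinder Omega T) u (laplx (cylinder Omega T) u).
  by apply: (xgetPex (cst 0)).
have Ldtu := dt_L2 hwt; have Ldtv := dt_L2 hvt.
have Lv : L2 (cylinder Omega T) v by case: v10.
have Lgu i := gradx_L2 (hwx i).
have pde := weak_solution_ae oO Lf weak hl hwt.
have test S w : measurable S -> S `<=` cylinder Omega T -> L2 (cylinder Omega T) w ->
    inner S (dt (cylinder Omega T) u) w - inner S (laplx (cylinder Omega T) u) w = inner S f w.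
  move=> mS SQ Lw; have LS g := @L2S R _ _ S g mQ mS SQ.
  have LtS := LS _ Ldtu; have LlS := LS _ Ll; have LwS := LS _ Lw.
  rewrite -innerBl//; apply: inner_ae_eq => //.
  - by have [] := L2B mS LtS LlS.
  - by have [] := LS _ Lf.
  - by case: LwS.
  - by apply: filterS pde => z pz /SQ /pz.
rewrite /a_loc /l_loc; congr (_ + _).
  rewrite -(test _ _ mQ (@subset_refl _ _) Lv).
  have /eqP := green_formula oO bO Lgu (conj Ll lapl) v10.
  by rewrite addr_eq0 => /eqP ->.
apply: eq_fsbigr => K; rewrite inE => KK; congr (_ * _).
have [mK KQ] := geometry_map_element geo KK (spline_space_unit_box spl KK).
(* the gradient terms of the bracket and of the pairing cancel *)
rewrite /normal_pairing opprD addrA addrK.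
exact: test.
Qed.
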